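(* Let $\Omega\subset\mathbb{R}^n$ be an $s$-regular domain with trivial cohomology, $1/2\le s\le 1$, let $0\le k\le n$, and let $\mathscr{H}=\{h_n:n=1,2,\dots\}$ be a decreasing sequence of positive real numbers converging to zero, with associated family of shape-regular meshes $\{\mathcal{T}_h\}_{h\in\mathscr{H}}$ of $\Omega$ and discrete spaces $\mathring{H}_h\Lambda^k(\Omega)$. Given a sequence $u_h\in\mathring{H}_h\Lambda^k(\Omega)$, $h\in\mathscr{H}$, satisfying $$\|\mathrm{d}u_h\|+\|\mathrm{d}_h^{*}u_h\|\le C\qquad\text{for all } h\in\mathscr{H},$$ where $C$ is a positive constant (independent of $h$), there exists a subsequence of $(u_h)_{h\in\mathscr{H}}$ which converges strongly in $L^2\Lambda^k(\Omega)$.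
   Context: **Continuous spaces.** $\Omega\subset\mathbb{R}^n$ is a bounded domain with trivial cohomology (all Betti numbers except the zeroth vanish, so there are no nontrivial harmonic forms). $\|\cdot\|$ and $(\cdot,\cdot)$ are the $L^2$ norm and inner product of differential forms, $\|\cdot\|_s$ the norm of $H^s\Lambda^k(\Omega)$. Let $H\Lambda^k(\Omega)=\{u\in L^2\Lambda^k(\Omega):\mathrm{d}u\in L^2\Lambda^{k+1}(\Omega)\}$ with norm $\|u\|_{H\Lambda}^2=\|u\|^2+\|\mathrm{d}u\|^2$. For $0\le k\le n-1$, $\mathring{H}\Lambda^k(\Omega)$ is the subspace of forms with vanishing trace on $\partial\Omega$; $\mathring{H}\Lambda^n(\Omega)=\{q\in L^2\Lambda^n(\Omega):\int_\Omega q=0\}$. The codifferential $\delta$ on $k$-forms is given (weakly) by $\star\delta=(-1)^k\mathrm{d}\star$, with $\star$ the Hodge star, so $\delta$ is the formal adjoint of $\mathrm{d}$; $H^{*}\Lambda^k(\Omega)=\{u\in L^2\Lambda^k(\Omega):\delta u\in L^2\Lambda^{k-1}(\Omega)\}$. Let $Z^k=\mathring{H}\Lambda^k(\Omega)\cap H^{*}\Lambda^k(\Omega)$. (Operators with range or domain out of the range $0\le k\le n$ are zero.) **$s$-regularity.** $\Omega$ is $s$-regular if for every $k$ there is $C$ such that every $z\in Z^k$ lies in $H^s\Lambda^k(\Omega)$ and $\|z\|_s^2\le C(\|\mathrm{d}z\|^2+\|\delta z\|^2)$. **Discrete spaces.** For each mesh $\mathcal{T}_h$ of mesh size $h$, the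 finite element spaces $\mathring{H}_h\Lambda^k=\mathring{H}_h\Lambda^k(\Omega)\subset\mathring{H}\Lambda^k(\Omega)$, $0\le k\le n$, are finite dimensional, and $0\to\mathring{H}_h\Lambda^0\xrightarrow{\mathrm{d}}\mathring{H}_h\Lambda^1\xrightarrow{\mathrm{d}}\cdots\xrightarrow{\mathrm{d}}\mathring{H}_h\Lambda^n\to0$ is an exact complex (e.g. the standard finite element de Rham complexes: Lagrange, Nédélec, Raviart–Thomas/BDM, discontinuous polynomials, with forms of zero trace). There are projections $\Pi_k:\mathring{H}\Lambda^k(\Omega)\to\mathring{H}_h\Lambda^k$ with $\mathrm{d}\Pi_k=\Pi_{k+1}\mathrm{d}$, bounded uniformly in $h$ in the $L^2$ and $H\Lambda^k$ norms (and in $L^p$ norms on $L^p\Lambda^k(\Omega)\cap\mathring{H}\Lambda^k(\Omega)$), satisfying $\|u-\Pi_k u\|\le Ch^s\|u\|_s$ for $u\in H^s\Lambda^k(\Omega)\cap\mathring{H}\Lambda^k(\Omega)$ with $C$ independent of $h$. **Discrete codifferential.** $\mathrm{d}_h^{*}:\mathring{H}_h\Lambda^k\to\mathring{H}_h\Lambda^{k-1}$ is defined by $(\mathrm{d}_h^{*}u_h,v_h)=(u_h,\mathrm{d}v_h)$ for all $v_h\in\mathring{H}_h\Lambda^{k-1}$ ($\mathrm{d}_h^{*}=0$ for $k=0$). *)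

(* Defs.v *)
From HB Require Import structures.
From mathcomp Require Import all_boot all_order all_algebra.
From mathcomp Require Import all_classical all_reals all_analysis.
Set Implicit Arguments.
Unset Strict Implicit.
Unset Printing Implicit Defensive.
Import Order.TTheory GRing.Theory Num.Theory.
Import numFieldNormedType.Exports.
Local Open Scope classical_set_scope.
Local Open Scope ring_scope.

(* 'rV[R]_n carries the product sigma-algebra, generated by the coordinates,
   as n.-tuple R does in the library. *)
Section measurable_rV.
Context {R : realType} (n : nat).

Let coord (i : 'I_n) (x : 'rV[R]_n) : R := x 0 i.

Let rV_set0 : g_sigma_preimage coord set0.
Proof. exact: sigma_algebra0. Qed.

Let rV_setC A : g_sigma_preimage coord A -> g_sigma_preimage coord (~` A).
Proof. exact: sigma_algebraC. Qed.

Let rV_bigcup (F : _^nat) : (forall i, g_sigma_preimage coord (F i)) ->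
  g_sigma_preimage coord (\bigcup_i (F i)).
Proof. exact: sigma_algebra_bigcup. Qed.

HB.instance Definition _ := @isMeasurable.Build default_measure_display
  'rV[R]_n (g_sigma_preimage coord) rV_set0 rV_setC rV_bigcup.

Lemma measurable_rVcoord (i : 'I_n) :
  measurable_fun [set: 'rV[R]_n] (fun x => x 0 i).
Proof.
move=> _ Y mY; rewrite setTI; apply: sub_sigma_algebra => /=.
rewrite -bigcup_seq/=; exists i => /=; first by rewrite mem_index_enum.
by exists Y => //; rewrite setTI.
Qed.

Lemma measurable_fun_rV d (T : measurableType d) (f : T -> 'rV[R]_n) :
  (forall i, measurable_fun [set: T] (fun t => f t 0 i)) ->
  measurable_fun [set: T] f.
Proof.
move=> mf.
suff h : g_sigma_preimage (fun i => coord i \o f) `<=` measurable.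
  move=> _ A mA; rewrite setTI; apply: h.
  by rewrite g_sigma_preimage_comp; exists A => //; rewrite setTI.
apply: smallest_sub; first exact: sigma_algebra_measurable.
rewrite -bigcup_seq; apply: bigcup_sub => i _ A [B mB <-]; exact: mf.
Qed.

End measurable_rV.

Section lebesgue_rV.
Context {R : realType}.

Definition rVcons n (p : R * 'rV[R]_n) : 'rV[R]_n.+1 :=
  \row_(i < n.+1) oapp (p.2 0) p.1 (unlift 0 i).

Lemma measurable_rVcons n : measurable_fun [set: R * 'rV[R]_n] (@rVcons n).
Proof.
apply: measurable_fun_rV => i.
case: (unliftP 0 i) => [j ->|->].
  rewrite (_ : (fun t => _) = (fun x : 'rV[R]_n => x 0 j) \o snd).
    by apply: measurableT_comp => //; exact: measurable_rVcoord.
  by apply/funext => t; rewrite mxE liftK.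
rewrite (_ : (fun t => _) = fst) //.
by apply/funext => t; rewrite mxE unlift_none.
Qed.

Section step.
Variables (n : nat) (mu : {sigma_finite_measure set 'rV[R]_n -> \bar R}).

Definition lebesgue_step : set 'rV[R]_n.+1 -> \bar R :=
  pushforward (lebesgue_measure \x mu)%E (@rVcons n).

Let lebesgue_step0 : lebesgue_step set0 = 0%E.
Proof. by rewrite /lebesgue_step /pushforward preimage_set0 measure0. Qed.

Let lebesgue_step_ge0 A : (0 <= lebesgue_step A)%E.
Proof. by rewrite /lebesgue_step /pushforward measure_ge0. Qed.

Let lebesgue_step_sigma_additive : semi_sigma_additive lebesgue_step.
Proof.
move=> F mF tF mUF; rewrite /lebesgue_step /pushforward preimage_bigcup.
have mpre A : measurable A -> measurable (@rVcons n @^-1` A).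
  by move=> mA; rewrite -[X in measurable X]setTI; exact: measurable_rVcons.
apply: measure_semi_sigma_additive; first by move=> k; exact: mpre.
- apply/trivIsetP => /= i j _ _ ij; rewrite -preimage_setI.
  by move/trivIsetP : tF => /(_ _ _ _ _ ij) ->//; rewrite preimage_set0.
- by rewrite -preimage_bigcup; exact: mpre.
Qed.

HB.instance Definition _ := isMeasure.Build _ _ _ lebesgue_step
  lebesgue_step0 lebesgue_step_ge0 lebesgue_step_sigma_additive.

Let lebesgue_step_sigma_finite : sigma_finite setT lebesgue_step.
Proof.
have /sigma_finiteP[F [FT ndF mF]] := sigma_finiteT (@lebesgue_measure R).
have /sigma_finiteP[G [GT ndG mG]] := sigma_finiteT mu.
pose uncons (x : 'rV[R]_n.+1) : R * 'rV[R]_n := (x 0 0, \row_j x 0 (lift 0 j)).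
have munc : measurable_fun setT uncons.
  apply/measurable_fun_pair => /=; first exact: measurable_rVcoord.
  apply: measurable_fun_rV => i.
  under eq_fun do rewrite mxE.
  exact: measurable_rVcoord.
have uncK : cancel (@rVcons n) uncons.
  move=> [a x]; rewrite /uncons; congr pair; first by rewrite mxE unlift_none.
  by apply/rowP => j; rewrite !mxE liftK.
exists (fun k => uncons @^-1` (F k `*` G k)).
  rewrite -preimage_bigcup (_ : \bigcup_k _ = setT) ?preimage_setT//.
  apply/seteqP; split => // -[x y] _.
  have [k _ Fk] : (\bigcup_k F k) x by rewrite -FT.
  have [l _ Gl] : (\bigcup_k G k) y by rewrite -GT.
  exists (maxn k l) => //; split => /=.
    exact: (subsetPset _ _ (ndF _ _ (leq_maxl k l))).
  exact: (subsetPset _ _ (ndG _ _ (leq_maxr k l))).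
move=> k; have [mFk Fk] := mF k; have [mGk Gk] := mG k; split.
  by rewrite -[X in measurable X]setTI; apply: munc => //; exact: measurableX.
rewrite /lebesgue_step /pushforward -comp_preimage.
rewrite (_ : uncons \o _ = id); last exact/funext.
by rewrite preimage_id product_measure1E// lte_mul_pinfty// ge0_fin_numE.
Qed.

HB.instance Definition _ := Measure_isSigmaFinite.Build _ _ _ lebesgue_step
  lebesgue_step_sigma_finite.

End step.

Fixpoint lebesgue_rV n : {sigma_finite_measure set 'rV[R]_n -> \bar R} :=
  if n is m.+1 then lebesgue_step (lebesgue_rV m) else \d_(0 : 'rV[R]_0).

End lebesgue_rV.

Section forms.
Context {R : realType} {n : nat}.
Implicit Types (Omega U : set 'rV[R]_n) (f g : 'rV[R]_n -> R).
Implicit Types (i : 'I_n) (A B : {set 'I_n}) (k j : nat).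
Local Notation leb := (@lebesgue_rV R n).

Definition euclid (x : 'rV[R]_n) : R := Num.sqrt (\sum_i x 0 i ^+ 2).

Definition partial i f : 'rV[R]_n -> R := 'D_(delta_mx 0 i) f.

Definition partials (s : seq 'I_n) f : 'rV[R]_n -> R := foldr partial f s.

Definition smooth_on U f := forall (s : seq 'I_n) x, U x ->
  {for x, continuous (partials s f)} /\
  forall i, derivable (partials s f) x (delta_mx 0 i).

Definition test_function Omega f :=
  smooth_on setT f /\
  exists K, [/\ compact K, K `<=` Omega & forall x, ~ K x -> f x = 0].

(* A differential form is given by its coefficients in the orthonormal basis
   e_A = dx_(a_1) /\ ... /\ dx_(a_j), A = {a_1 < ... < a_j}: u x A is the
   coefficient of e_A at the point x.  The exterior algebra is thus
   {ffun {set 'I_n} -> R}, and k-forms are the elements whose coefficients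
   vanish unless #|A| = k.  Forms on Omega are represented by functions on
   R^n, of which only the restriction to Omega, up to null sets, matters. *)
Definition dform := 'rV[R]_n -> {ffun {set 'I_n} -> R}.

Implicit Types u v w z : dform.

(* dx_i /\ e_(B \ i) = wedge_sign i B *: e_B for i \in B *)
Definition wedge_sign i B : R := (-1) ^+ #|[set j in B | (j < i)%N]%SET|.

Definition extd u : dform := fun x =>
  [ffun B : {set 'I_n} =>
    \sum_(i in B) wedge_sign i B * partial i (fun y => u y (B :\ i)) x].

(* e_A /\ e_(~: A) = star_sign A *: e_setT: the sign counts the inversions of
   the shuffle. Hence star e_A = star_sign A *: e_(~: A). *)
Definition star_sign A : R :=
  (-1) ^+ #|[set p : 'I_n * 'I_n |
              [&& p.1 \in A, p.2 \notin A & (p.2 < p.1)%N]]%SET|.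

Definition star u : dform := fun x =>
  [ffun B : {set 'I_n} => star_sign (~: B) * u x (~: B)].

Definition bounded_domain Omega :=
  [/\ open Omega, connected Omega, Omega !=set0 & bounded_set Omega].

Definition smooth_form Omega k u :=
  forall A, smooth_on Omega (fun x => u x A) /\
    (#|A| != k -> forall x, Omega x -> u x A = 0).

(* The de Rham cohomology spaces in degrees 1, ..., n, whose dimensions are
   the Betti numbers b_1, ..., b_n, are zero. *)
Definition trivial_cohomology Omega :=
  forall k, (k < n)%N -> forall w, smooth_form Omega k.+1 w ->
    (forall x, Omega x -> extd w x = 0) ->
    exists2 v, smooth_form Omega k v & forall x, Omega x -> extd v x = w x.

Definition L2Lambda Omega k u :=
  forall A, patch (cst 0) Omega (fun x => u x A) \in Lfun leb 2%:E /\
    (#|A| != k -> {ae leb, forall x, Omega x -> u x A = 0}).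

Definition inner Omega u v : R :=
  \int[leb]_(x in Omega) (\sum_A u x A * v x A).

Definition l2norm Omega u : R := Num.sqrt (inner Omega u u).

Definition Lpnorm Omega (p : \bar R) u : \bar R :=
  'N[leb]_p[patch (cst 0%E) Omega
              (fun x => (Num.sqrt (\sum_A u x A ^+ 2))%:E)]%E.

(* The coordinate formula of extd holds in the sense of distributions. *)
Definition weak_extd Omega u w :=
  forall B f, test_function Omega f ->
    \int[leb]_(x in Omega) (w x B * f x) =
    - \sum_(i in B) wedge_sign i B *
        \int[leb]_(x in Omega) (u x (B :\ i) * partial i f x).

(* w = d u, for a k-form u and a square integrable w: such a w is unique up to
   null sets, if it exists. *)
Definition is_d Omega k u w := L2Lambda Omega k.+1 w /\ weak_extd Omega u w.

(* w = delta u, for a k-form u and a square integrable w: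
   star w = (-1)^k d (star u).  If k = 0, the weak equation forces w = 0. *)
Definition is_delta Omega k u w :=
  L2Lambda Omega k.-1 w /\ weak_extd Omega (star u) ((-1) ^+ k *: star w).

Definition HLambda Omega k u :=
  L2Lambda Omega k u /\ exists w, is_d Omega k u w.

Definition Hstar Omega k u :=
  L2Lambda Omega k u /\ exists w, is_delta Omega k u w.

(* For a bounded domain whose boundary need not be smooth, the trace of u in
   HLambda is the functional on Hstar given by Green's formula
   \int_(bd Omega) tr u /\ tr (star v) = (d u, v) - (u, delta v). *)
Definition trace_zero Omega k u :=
  forall du v dv, is_d Omega k u du ->
    L2Lambda Omega k.+1 v -> is_delta Omega k.+1 v dv ->
    inner Omega du v - inner Omega u dv = 0.

(* The square integrable k-forms with square integrable d and zero trace; in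
   top degree, those with zero mean. *)
Definition Hring Omega k u :=
  if k == n then
    L2Lambda Omega n u /\ \int[leb]_(x in Omega) u x [set: 'I_n]%SET = 0
  else HLambda Omega k u /\ trace_zero Omega k u.

Definition Zspace Omega k z := Hring Omega k z /\ Hstar Omega k z.

Definition weak_partial Omega i f g :=
  forall phi, test_function Omega phi ->
    \int[leb]_(x in Omega) (g x * phi x) =
    - \int[leb]_(x in Omega) (f x * partial i phi x).

Definition weak_gradient Omega u (g : 'I_n -> dform) :=
  forall i A, patch (cst 0) Omega (fun x => g i x A) \in Lfun leb 2%:E /\
    weak_partial Omega i (fun x => u x A) (fun x => g i x A).

(* Square of the seminorm, for 0 < s <= 1.
   For s < 1 this is the Sobolev-Slobodeckij seminorm.
   For s = 1 the weak gradient is unique up to null sets, so the infimum ranges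
   over at most one value, and it is +oo when u has no weak gradient in L^2. *)
Definition Hs_seminorm2 Omega (s : R) u : \bar R :=
  if s == 1 then
    ereal_inf [set (\sum_i l2norm Omega (g i) ^+ 2)%:E |
               g in weak_gradient Omega u]
  else
    (\int[leb]_(x in Omega) \int[leb]_(y in Omega)
      ((\sum_A (u x A - u y A) ^+ 2) /
        (euclid (x - y) `^ (n%:R + 2 * s)))%:E)%E.

Definition HsLambda Omega (s : R) k u :=
  L2Lambda Omega k u /\ (Hs_seminorm2 Omega s u < +oo)%E.

Definition Hs_norm Omega (s : R) u : R :=
  Num.sqrt (l2norm Omega u ^+ 2 + fine (Hs_seminorm2 Omega s u)).

Definition s_regular Omega (s : R) :=
  forall k, (k <= n)%N -> exists C : R, forall z, Zspace Omega k z ->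
    HsLambda Omega s k z /\
    forall dz deltaz, is_d Omega k z dz -> is_delta Omega k z deltaz ->
      Hs_norm Omega s z ^+ 2 <=
        C * (l2norm Omega dz ^+ 2 + l2norm Omega deltaz ^+ 2).

Definition diam (K : set 'rV[R]_n) : R :=
  sup [set euclid (x - y) | x in K & y in K].

(* The cells may be simplices, cubes, polytopes, curved elements, ... *)
Definition mesh_of Omega (T : set (set 'rV[R]_n)) :=
  [/\ finite_set T,
      forall K, T K -> compact K /\ interior K !=set0,
      trivIset T interior &
      \bigcup_(K in T) K = closure Omega].

Definition mesh_size (T : set (set 'rV[R]_n)) : R := sup [set diam K | K in T].

(* Every cell K of every mesh contains a Euclidean ball of radius at least
   diam K / sigma. *)
Definition shape_regular (T : nat -> set (set 'rV[R]_n)) :=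
  exists2 sigma : R, 0 < sigma & forall m K, T m K ->
    exists x r, [/\ 0 < r, forall y, euclid (y - x) < r -> K y &
                    diam K <= sigma * r].

(* A subspace of L^2 is represented by the set of all representatives of its
   elements. *)
Definition fe_subspace Omega k (V : set dform) :=
  [/\ V `<=` Hring Omega k,
      V 0,
      forall (a : R) u v, V u -> V v -> V (a *: u + v),
      forall u v, V u -> L2Lambda Omega k v ->
        {ae leb, forall x, Omega x -> u x = v x} -> V v &
      exists N (b : 'I_N -> dform), (forall l, V (b l)) /\
        forall v, V v -> exists c : 'I_N -> R,
          {ae leb, forall x, Omega x -> v x = \sum_l c l *: b l x}].

Definition exact_complex Omega (V : nat -> set dform) :=
  (forall k v w, (k < n)%N -> V k v -> is_d Omega k v w -> V k.+1 w) /\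
  (forall k v, (k <= n)%N -> V k v -> is_d Omega k v 0 ->
    if k is j.+1 then exists2 w, V j w & is_d Omega j w v
    else {ae leb, forall x, Omega x -> v x = 0}).

Definition fe_complex Omega (V : nat -> set dform) :=
  (forall k, (k <= n)%N -> fe_subspace Omega k (V k)) /\
  exact_complex Omega V.

(* The projections onto the discrete spaces V m k, of mesh size h m. *)
Record bounded_projections Omega (s : R) (h : nat -> R)
    (V : nat -> nat -> set dform) (Pi : nat -> nat -> dform -> dform) : Prop := {
  Pi_range : forall m k u, (k <= n)%N -> Hring Omega k u -> V m k (Pi m k u) ;
  Pi_linear : forall m k (a : R) u v, (k <= n)%N ->
    Hring Omega k u -> Hring Omega k v ->
    {ae leb, forall x, Omega x ->
      Pi m k (a *: u + v) x = a *: Pi m k u x + Pi m k v x} ;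
  Pi_id : forall m k v, (k <= n)%N -> V m k v ->
    {ae leb, forall x, Omega x -> Pi m k v x = v x} ;
  Pi_commute : forall m k u du, (k < n)%N -> Hring Omega k u ->
    is_d Omega k u du -> is_d Omega k (Pi m k u) (Pi m k.+1 du) ;
  Pi_L2 : forall k, (k <= n)%N -> exists C : R, forall m u,
    Hring Omega k u -> l2norm Omega (Pi m k u) <= C * l2norm Omega u ;
  Pi_HLambda : forall k, (k <= n)%N -> exists C : R, forall m u du dPiu,
    Hring Omega k u -> is_d Omega k u du -> is_d Omega k (Pi m k u) dPiu ->
    Num.sqrt (l2norm Omega (Pi m k u) ^+ 2 + l2norm Omega dPiu ^+ 2) <=
    C * Num.sqrt (l2norm Omega u ^+ 2 + l2norm Omega du ^+ 2) ;
  Pi_Lp : forall k (p : \bar R), (k <= n)%N -> (1 <= p)%E ->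
    exists C : R, forall m u,
      Hring Omega k u -> (Lpnorm Omega p u < +oo)%E ->
      (Lpnorm Omega p (Pi m k u) <= C%:E * Lpnorm Omega p u)%E ;
  Pi_approx : forall k, (k <= n)%N -> exists C : R, forall m u,
    HsLambda Omega s k u -> Hring Omega k u ->
    l2norm Omega (u - Pi m k u) <= C * h m `^ s * Hs_norm Omega s u
}.

(* w = d_h^* u for u in V k *)
Definition is_dh_star Omega (V : nat -> set dform) k u w :=
  if k is j.+1 then
    V j w /\ forall v dv, V j v -> is_d Omega j v dv ->
      inner Omega w v = inner Omega u dv
  else {ae leb, forall x, Omega x -> w x = 0}.

End forms.
Arguments dform : clear implicits.

(* Main.v *)
Require Import Defs.
From mathcomp Require Import all_boot all_order all_algebra.
From mathcomp Require Import all_classical all_reals all_analysis.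
From mathcomp Require Import measurable_realfun ring lra.
Import Order.TTheory GRing.Theory Num.Theory.
Import numFieldNormedType.Exports.
Set Implicit Arguments.
Unset Strict Implicit.
Unset Printing Implicit Defensive.
Local Open Scope classical_set_scope.
Local Open Scope ring_scope.

(** Let [Z] be the space of forms with vanishing trace that have a square integrable
    exterior derivative and codifferential.  The theorem holds because every
    discrete form is within [O(h^s)] of a form of [Z], with norms under control, and
    because bounded subsets of [Z] are relatively compact in [L^2].

    Compactness.  By [s]-regularity a bounded subset of [Z] is bounded in [H^s], so
    for each fixed mesh the projection onto the discrete space moves its elements
    by at most [C h^s].  The set is thus approximated, to any accuracy, by
    bounded sets of finite dimension: the projections play the part of Rellich's
    theorem ([cauchy_subsequence]).

    Comparison ([discrete_near_continuous]).  Let [u] be discrete, [g] its discrete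
    codifferential, and [P] the orthogonal projection onto the closure of the
    exact forms.  There is [z] in [Z] with [d z = d u] and [delta z = g - P g].  The
    discrete form [e = u - Pi z] is closed, hence [e = d p] with [p] discrete.  Let
    [q = p - P p]; it lies in [Z], with [d q = e] and [delta q = 0].  Then
    [|e|^2 = (u - z, d p) + (z - Pi z, e)] and
    [(u - z, d p) = (g, p) - (g - P g, p) = (g, P p) = (g, p) - (g, q)].  As
    [p - Pi q] is discrete and closed, it is orthogonal to [g], and what remains is
    [|e|^2 = - (g, q - Pi q) + (z - Pi z, e)].  The two projection errors are
    [O(h^s)] by [s]-regularity applied to [q] and to [z].

    Existence of [z] ([hodge_split]).  One takes [z = u - b] where [b] represents, on
    the exact forms [d q], the functional [(u, d q) - (g - P g, q)].  It is bounded
    since [(g - P g, q) = (g - P g, q - P q)] and since [s]-regularity applied to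
    [q - P q] is a Poincare inequality; this first requires the case of a zero
    codifferential ([coexact_part]).  That a limit of exact forms is closed and has
    vanishing trace follows from [d d = 0] and [delta delta = 0], that is, from
    Schwarz's theorem for test functions; that [z] has the required
    codifferential follows from testing with the forms [f dx_A], which have
    vanishing trace by integration by parts. *)

(** * Spaces with a semi-inner product *)

(** Forms are functions rather than classes modulo null sets, and their inner
    product is bilinear only where the integrals converge.  Hence definiteness is
    not among the axioms, and bilinearity is relative to a set [L]. *)
Record semi_inner (R : realType) (E : lmodType R) (L : set E)
    (ip : E -> E -> R) : Prop := {
  si_mem0 : L 0 ;
  si_memP : forall a u v, L u -> L v -> L (a *: u + v) ;
  si_sym : forall u v, ip u v = ip v u ;
  si_linl : forall a u v w, L u -> L v -> L w ->
    ip (a *: u + v) w = a * ip u w + ip v w ;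
  si_ge0 : forall u, 0 <= ip u u }.

Section semi_inner_theory.
Context {R : realType} {E : lmodType R} (L : set E) (ip : E -> E -> R).
Hypothesis H : semi_inner L ip.
Implicit Types (u v w x y : E) (a c t e M : R).

Local Notation nrm u := (Num.sqrt (ip u u)).

Lemma si_memD u v : L u -> L v -> L (u + v).
Proof. by move=> Lu Lv; rewrite -[u]scale1r; exact: (si_memP H). Qed.

Lemma si_memZ a u : L u -> L (a *: u).
Proof. by move=> Lu; rewrite -[_ *: _]addr0; apply: (si_memP H) => //; exact: (si_mem0 H). Qed.

Lemma si_memN u : L u -> L (- u).
Proof. by move=> Lu; rewrite -scaleN1r; exact: si_memZ. Qed.

Lemma si_memB u v : L u -> L v -> L (u - v).
Proof. by move=> Lu Lv; apply: si_memD => //; exact: si_memN. Qed.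

Lemma si_mem_sum N (c : nat -> R) (b : nat -> E) : (forall l, L (b l)) ->
  L (\sum_(l < N) c l *: b l).
Proof.
move=> Lb; elim: N => [|N IH]; first by rewrite big_ord0; exact: (si_mem0 H).
by rewrite big_ord_recr; apply: si_memD => //; exact: si_memZ.
Qed.

Hint Resolve si_memD si_memZ si_memN si_memB : core.

Lemma ipDl u v w : L u -> L v -> L w -> ip (u + v) w = ip u w + ip v w.
Proof. by move=> *; rewrite -[u in LHS]scale1r (si_linl H)// mul1r. Qed.

Lemma ip0l w : L w -> ip 0 w = 0.
Proof.
move=> Lw; have L0 := si_mem0 H; have := ipDl L0 L0 Lw.
by rewrite addr0 => /eqP; rewrite -subr_eq0 opprD addrA subrr sub0r oppr_eq0 => /eqP.
Qed.

Lemma ipZl a u w : L u -> L w -> ip (a *: u) w = a * ip u w.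
Proof.
move=> Lu Lw; rewrite -[a *: u]addr0 (si_linl H)//; last exact: (si_mem0 H).
by rewrite ip0l// addr0.
Qed.

Lemma ipNl u w : L u -> L w -> ip (- u) w = - ip u w.
Proof. by move=> *; rewrite -scaleN1r ipZl// mulN1r. Qed.

Lemma ipBl u v w : L u -> L v -> L w -> ip (u - v) w = ip u w - ip v w.
Proof. by move=> *; rewrite ipDl ?ipNl//; exact: si_memN. Qed.

Lemma ipDr u v w : L u -> L v -> L w -> ip w (u + v) = ip w u + ip w v.
Proof. by move=> *; rewrite !(si_sym H w); exact: ipDl. Qed.

Lemma ip0r w : L w -> ip w 0 = 0.
Proof. by rewrite (si_sym H); exact: ip0l. Qed.

Lemma ipZr a u w : L u -> L w -> ip w (a *: u) = a * ip w u.
Proof. by move=> *; rewrite !(si_sym H w); exact: ipZl. Qed.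

Lemma ipNr u w : L u -> L w -> ip w (- u) = - ip w u.
Proof. by move=> *; rewrite !(si_sym H w); exact: ipNl. Qed.

Lemma ipBr u v w : L u -> L v -> L w -> ip w (u - v) = ip w u - ip w v.
Proof. by move=> *; rewrite !(si_sym H w); exact: ipBl. Qed.

Lemma nrm_ge0 u : 0 <= nrm u.
Proof. exact: sqrtr_ge0. Qed.

Lemma nrm_sqr u : nrm u ^+ 2 = ip u u.
Proof. exact: (sqr_sqrtr (si_ge0 H u)). Qed.

Lemma nrm_le u M : 0 <= M -> ip u u <= M ^+ 2 -> nrm u <= M.
Proof. by move=> M0 uM; rewrite -(ger0_norm M0) -sqrtr_sqr ler_sqrt// sqr_ge0. Qed.

Lemma nrm0 : nrm 0 = 0.
Proof. by rewrite ip0l ?sqrtr0//; exact: (si_mem0 H). Qed.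

Lemma ip_addscale u v a : L u -> L v ->
  ip (u + a *: v) (u + a *: v) = ip u u + 2 * a * ip u v + a ^+ 2 * ip v v.
Proof.
move=> Lu Lv; rewrite !(ipDl, ipDr, ipZl, ipZr)//; auto.
by rewrite (si_sym H v u); ring.
Qed.

(** A nonnegative quadratic polynomial has a nonpositive discriminant, even when it
    degenerates because [c = 0]: seminorms may vanish on nonzero vectors. *)
Lemma quadratic_disc e b c : 0 <= c -> 0 <= e ->
  (forall a, 0 <= e + 2 * a * b + a ^+ 2 * c) -> b ^+ 2 <= e * c.
Proof.
move=> c0 e0 q; have [c00|cn0] := eqVneq c 0.
  rewrite c00 mulr0; have [->|b0] := eqVneq b 0; first by rewrite expr0n.
  have := q (- (e + 1) / (2 * b)); rewrite c00 mulr0 addr0.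
  have -> : 2 * (- (e + 1) / (2 * b)) * b = - (e + 1) by field.
  by lra.
have cgt0 : 0 < c by rewrite lt_def cn0.
have := q (- b / c).
have -> : e + 2 * (- b / c) * b + (- b / c) ^+ 2 * c = (e * c - b ^+ 2) / c by field.
by rewrite pmulr_lge0 ?invr_gt0// subr_ge0.
Qed.

Lemma cauchy_schwarz u v : L u -> L v -> `|ip u v| <= nrm u * nrm v.
Proof.
move=> Lu Lv; rewrite -(@ler_pXn2r _ 2)// ?nnegrE ?mulr_ge0 ?nrm_ge0//.
rewrite exprMn !nrm_sqr real_normK ?num_real//.
apply: quadratic_disc; rewrite ?(si_ge0 H)// => a.
by rewrite -ip_addscale ?(si_ge0 H).
Qed.

Lemma ip_le u v : L u -> L v -> ip u v <= nrm u * nrm v.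
Proof. by move=> Lu Lv; exact: le_trans (ler_norm _) (cauchy_schwarz Lu Lv). Qed.

Lemma nrmD u v : L u -> L v -> nrm (u + v) <= nrm u + nrm v.
Proof.
move=> Lu Lv; apply: nrm_le; first by rewrite addr_ge0 ?nrm_ge0.
have -> : ip (u + v) (u + v) = ip u u + 2 * ip u v + ip v v.
  by have := ip_addscale 1 Lu Lv; rewrite scale1r expr1n mulr1 mul1r.
rewrite sqrrD !nrm_sqr; have := ip_le Lu Lv.
by lra.
Qed.

Lemma nrmN u : L u -> nrm (- u) = nrm u.
Proof. by move=> Lu; rewrite ipNl ?ipNr ?opprK//; auto. Qed.

Lemma nrmZ a u : L u -> nrm (a *: u) = `|a| * nrm u.
Proof.
move=> Lu; rewrite ipZl ?ipZr//; last by auto.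
by rewrite mulrA -expr2 sqrtrM ?sqr_ge0// sqrtr_sqr.
Qed.

Lemma nrmB u v : L u -> L v -> nrm (u - v) <= nrm u + nrm v.
Proof. by move=> Lu Lv; rewrite -(nrmN Lv); apply: nrmD; auto. Qed.

Lemma nrmC u v : L u -> L v -> nrm (u - v) = nrm (v - u).
Proof. by move=> Lu Lv; rewrite -nrmN ?opprB//; auto. Qed.

Lemma nrm_tri w u v : L u -> L v -> L w ->
  nrm (u - v) <= nrm (u - w) + nrm (w - v).
Proof. by move=> *; rewrite -[u - v](subrKA w); apply: nrmD; auto. Qed.

(** The closure for the seminorm: it contains every vector of [L] at distance zero
    from one of its elements. *)
Definition sclosure (X : set E) : set E :=
  [set v | L v /\ forall e, 0 < e -> exists2 x, X x & nrm (x - v) <= e].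

(** Continuity of the inner product extends identities from a set to its closure. *)
Lemma sclosure_ip (X : set E) v w w' : X `<=` L -> L w -> L w' -> sclosure X v ->
  (forall x, X x -> ip x w = ip x w') -> ip v w = ip v w'.
Proof.
move=> XL Lw Lw' [Lv clv] Xw; apply/eqP; rewrite -subr_eq0 -normr_le0.
rewrite -ipBr//; apply/ler_addgt0Pr => e e0; rewrite add0r.
have M0 : 0 < nrm (w - w') + 1 by rewrite ltr_pwDr// nrm_ge0.
have [x Xx xv] := clv _ (divr_gt0 e0 M0).
have Lx := XL _ Xx.
have -> : ip v (w - w') = ip (v - x) (w - w').
  by rewrite [RHS]ipBl//; auto; rewrite (ipBr _ _ Lx)// (Xw _ Xx) subrr subr0.
rewrite (le_trans (cauchy_schwarz _ _))//; auto.
rewrite nrmC// (le_trans (ler_wpM2r (nrm_ge0 _) xv))//.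
by rewrite mulrAC ler_pdivrMr// ler_pM2l// lerDl.
Qed.

Section riesz.
Variable L' : set E.
Hypothesis L'L : L' `<=` L.
Hypothesis compl : forall x : nat -> E, (forall i, L' (x i)) ->
  (forall e, 0 < e -> exists N, forall i j, (N <= i)%N -> (N <= j)%N ->
     nrm (x i - x j) <= e) ->
  exists2 v, L' v & forall e, 0 < e -> exists N, forall i, (N <= i)%N -> nrm (x i - v) <= e.

(** Riesz representation on a subspace that need not be closed: a minimising
    sequence of [|x|^2 - 2 F x] is Cauchy by the parallelogram law, and its limit
    represents [F].  The functional is given by its graph [X], because its value at
    [d q] will be expressed through [q], which [d q] does not determine. *)
Lemma riesz (X : E -> R -> Prop) M : X 0 0 ->
  (forall a x y t t', X x t -> X y t' -> X (a *: x + y) (a * t + t')) ->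
  (forall x t, X x t -> L' x) ->
  (forall x t, X x t -> `|t| <= M * nrm x) ->
  exists v, [/\ L' v, sclosure [set x | exists t, X x t] v &
    forall x t, X x t -> ip v x = t].
Proof.
move=> X0 Xlin XL' Xbd.
have XL x t : X x t -> L x by move=> /XL'/L'L.
pose J x t := ip x x - 2 * t.
pose S := [set r | exists x t, X x t /\ r = J x t].
have Slb : lbound S (- M ^+ 2).
  move=> _ [x [t [Xxt ->]]]; rewrite /J -nrm_sqr.
  have := Xbd _ _ Xxt; rewrite ler_norml => /andP[_ tM].
  have : 0 <= (nrm x - M) ^+ 2 by rewrite sqr_ge0.
  by rewrite sqrrB; lra.
have S0 : S !=set0 by exists (J 0 0), 0, 0.
have hinfS : has_inf S by split => //; exists (- M ^+ 2).
pose m := inf S.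
have mJ x t : X x t -> m <= J x t.
  by move=> Xxt; apply: ge_inf; [case: hinfS | exists x, t].
have eps_gt0 i : 0 < (i.+1%:R^-1 : R) by rewrite invr_gt0 ltr0n.
have /choice[p pP] i : exists p : E * R, X p.1 p.2 /\ J p.1 p.2 < m + i.+1%:R^-1.
  have [_ [x [t [Xxt ->]]] lt] := inf_adherent (eps_gt0 i) hinfS.
  by exists (x, t).
have Xp i := (pP i).1; have Jp i := (pP i).2.
have Lp i : L (p i).1 := XL _ _ (Xp i).
have archi e : 0 < e -> exists N, forall i, (N <= i)%N -> i.+1%:R^-1 <= e.
  move=> e0; have [N _ NP] := near_infty_natSinv_lt (PosNum e0).
  by exists N => i /NP /ltW.
have cau e : 0 < e -> exists N, forall i j, (N <= i)%N -> (N <= j)%N ->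
    nrm ((p i).1 - (p j).1) <= e.
  move=> e0; have [N Nle] := archi (e ^+ 2 / 4) ltac:(by rewrite divr_gt0 ?exprn_gt0).
  exists N => i j /Nle iN /Nle jN; apply: nrm_le; first exact: ltW.
  have Xij : X (2^-1 *: ((p i).1 + (p j).1)) (2^-1 * ((p i).2 + (p j).2)).
    have := Xlin 1 _ _ _ _ (Xp i) (Xp j); rewrite scale1r mul1r => Xs.
    by have := Xlin 2^-1 _ _ _ _ Xs X0; rewrite !addr0.
  have := mJ _ _ Xij; have := Jp i; have := Jp j; rewrite /J => h1 h2.
  rewrite ipZl ?ipZr//; auto.
  have := ip_addscale 1 (Lp i) (Lp j); rewrite scale1r => ->.
  have := ip_addscale (-1) (Lp i) (Lp j); rewrite scaleN1r => ->.
  move: h1 h2 iN jN; move: (i.+1%:R^-1) (j.+1%:R^-1) => e1 e2; lra.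
have [v L'v pv] := compl (fun i => XL' _ _ (Xp i)) cau.
have Lv := L'L L'v.
exists v; split => //.
  split => // e /pv[N Ne]; exists (p N).1; first by exists (p N).2.
  exact: Ne.
move=> x t Xxt; have Lx := XL _ _ Xxt.
apply/eqP; rewrite -subr_eq0 -normr_le0; apply/ler_addgt0Pr => e e0; rewrite add0r.
have K0 : 0 < 2 * (nrm x + 1) by rewrite mulr_gt0// ltr_pwDr// nrm_ge0.
have d0 : 0 < e / (2 * (nrm x + 1)) by rewrite divr_gt0.
have [N1 Npv] := pv _ d0.
have [N2 Narchi] := archi _ (exprn_gt0 2 d0).
pose i := maxn N1 N2.
have near : nrm (v - (p i).1) <= e / (2 * (nrm x + 1)).
  by rewrite nrmC//; apply: Npv; exact: leq_maxl.
(* near a minimum the first variation is small *)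
have disc : (ip (p i).1 x - t) ^+ 2 <= i.+1%:R^-1 * ip x x.
  apply: quadratic_disc; rewrite ?(si_ge0 H)//.
  move=> a.
  have Xa := Xlin a _ _ _ _ Xxt (Xp i).
  have := mJ _ _ Xa; rewrite /J [a *: x + _]addrC ip_addscale//.
  have := Jp i; rewrite /J; move: (i.+1%:R^-1) => e1; lra.
have crit : `|ip (p i).1 x - t| <= e / (2 * (nrm x + 1)) * nrm x.
  rewrite -(@ler_pXn2r _ 2)// ?nnegrE ?mulr_ge0 ?nrm_ge0//; last exact: ltW.
  rewrite real_normK ?num_real// exprMn nrm_sqr.
  apply: le_trans disc _.
  by rewrite ler_wpM2r ?(si_ge0 H)//; apply: Narchi; exact: leq_maxr.
have -> : ip v x - t = ip (v - (p i).1) x + (ip (p i).1 x - t).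
  by rewrite ipBl// addrA subrK.
rewrite (le_trans (ler_normD _ _))//.
have cs := le_trans (cauchy_schwarz (si_memB Lv (Lp i)) Lx) (ler_wpM2r (nrm_ge0 x) near).
rewrite (le_trans (lerD cs crit))//.
rewrite [leLHS](_ : _ = e * (nrm x / (nrm x + 1))); last first.
  by field; rewrite gt_eqF// ltr_pwDr// nrm_ge0.
rewrite ger_pMr// ler_pdivrMr ?ltr_pwDr ?nrm_ge0// mul1r.
by rewrite lerDl.
Qed.

Lemma projection (X : set E) u : X 0 ->
  (forall a x y, X x -> X y -> X (a *: x + y)) -> X `<=` L' -> L u ->
  exists v, [/\ L' v, sclosure X v & forall x, X x -> ip v x = ip u x].
Proof.
move=> X0 Xlin XL' Lu.
have [||||v [L'v [Lv clv] pv]] := @riesz (fun x t => X x /\ t = ip u x) (nrm u).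
- by rewrite ip0r.
- move=> a x y t t' [Xx ->] [Xy ->]; split; first exact: Xlin.
  by rewrite !(si_sym H u) (si_linl H)//; apply: L'L; exact: XL'.
- by move=> x t [/XL'].
- by move=> x t [Xx ->]; apply: cauchy_schwarz => //; apply: L'L; exact: XL'.
exists v; split => //; last by move=> x Xx; apply: pv.
by split => // e /clv[x [t [Xx _]] xv]; exists x.
Qed.

End riesz.

Section ultra.
Variable F : set_system nat.
Hypothesis UF : UltraFilter F.

Definition cauchy_along (x : nat -> E) := forall e, 0 < e ->
  exists2 A, F A & forall i j, A i -> A j -> nrm (x i - x j) <= e.

Lemma ultra_bounded (c : nat -> R) M e : (forall i, `|c i| <= M) -> 0 < e ->
  exists2 A, F A & forall i j, A i -> A j -> `|c i - c j| <= e.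
Proof.
move=> cM e0.
have : compact `[- M, M] := @segment_compact R (- M) M.
have PF : ProperFilter (c @ F) by exact: fmap_proper_filter.
move=> /(_ (c @ F) PF)[|p [_ cp]].
  have cI i : (c @^-1` `[- M, M]) i by rewrite /= in_itv/= -ler_norml.
  exact: (@filterS _ F _ setT _ (fun i _ => cI i) filterT).
have : nbhs p (ball p (e / 2)) by apply: nbhsx_ballx; rewrite divr_gt0.
have [cpe _|Fc /(cp (~` ball p (e / 2)) _ Fc)[r [] //]] := in_ultra_setVsetC (c @^-1` ball p (e / 2)) UF.
exists (c @^-1` ball p (e / 2)) => // i j /= pi pj.
rewrite -[c i - c j](subrKA p) [e]splitr (le_trans (ler_normD _ _))// lerD//.
  by rewrite distrC; exact: ltW.
exact: ltW.
Qed.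

Lemma cauchy_alongD (x y : nat -> E) : (forall i, L (x i)) -> (forall i, L (y i)) ->
  cauchy_along x -> cauchy_along y -> cauchy_along (fun i => x i + y i).
Proof.
move=> Lx Ly cx cy e e0; have e20 : 0 < e / 2 by rewrite divr_gt0.
have [A FA hA] := cx _ e20; have [B FB hB] := cy _ e20.
exists (A `&` B); first exact: filterI.
move=> i j [Ai Bi] [Aj Bj]; rewrite opprD addrACA [e]splitr.
by rewrite (le_trans (nrmD _ _))//; auto; rewrite lerD ?hA ?hB.
Qed.

(** Being Cauchy is preserved by approximation up to every [e]; the approximating
    sequence may change with [e]. *)
Lemma cauchy_along_approx (x : nat -> E) : (forall i, L (x i)) ->
  (forall e, 0 < e -> exists y : nat -> E, [/\ forall i, L (y i), cauchy_along y &
    exists2 A, F A & forall i, A i -> nrm (x i - y i) <= e]) -> cauchy_along x.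
Proof.
move=> Lx xy e e0; have e40 : 0 < e / 4 by rewrite divr_gt0.
have [y [Ly cy [A FA xyA]]] := xy _ e40; have [B FB hB] := cy _ e40.
exists (A `&` B); first exact: filterI.
move=> i j [Ai Bi] [Aj Bj].
rewrite (le_trans (nrm_tri (Lx i) (Lx j) (Ly i)))//.
have h1 := xyA _ Ai; have h2 := xyA _ Aj; have h3 := hB _ _ Bi Bj.
have h4 := nrm_tri (Ly i) (Lx j) (Ly j); rewrite (nrmC (Ly j) (Lx j)) in h4.
by lra.
Qed.

(** A bounded sequence in the span of finitely many vectors.  The vectors may be
    dependent, so the coefficients need not be bounded: if the last vector is at
    positive distance from the span of the others its coefficient is bounded,
    and otherwise the last vector can be traded, up to any error and separately
    for every term, for a vector of that span. *)
Lemma cauchy_along_span N (b : nat -> E) (c : nat -> nat -> R) M :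
  (forall l, L (b l)) ->
  (forall i, nrm (\sum_(l < N) c i l *: b l) <= M) ->
  cauchy_along (fun i => \sum_(l < N) c i l *: b l).
Proof.
move=> Lb; elim: N => [|N IH] in c M *.
  move=> _ e e0; exists setT; first exact: filterT.
  by move=> i j _ _; rewrite !big_ord0 subrr nrm0 ltW.
move=> yM.
have Ls k (d : nat -> R) := si_mem_sum k d Lb.
have [[d d0 far]|close] := pselect (exists2 d, 0 < d &
    forall w : nat -> R, d <= nrm (b N - \sum_(l < N) w l *: b l)).
  have cM i : `|c i N| <= M / d.
    rewrite ler_pdivlMr//; have [->|cN0] := eqVneq (c i N) 0.
      by rewrite normr0 mul0r (le_trans (nrm_ge0 _) (yM i)).
    apply: le_trans (yM i); rewrite big_ord_recr/=.
    have -> : \sum_(l < N) c i l *: b l + c i N *: b N =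
        c i N *: (b N - \sum_(l < N) (- (c i N)^-1 * c i l) *: b l).
      rewrite scalerBr scaler_sumr addrC; congr (_ + _); rewrite -sumrN.
      apply: eq_bigr => l _; rewrite scalerA -scaleNr; congr (_ *: _).
      by rewrite mulNr mulrN opprK mulVKf.
    rewrite nrmZ; first by apply: ler_wpM2l => //; exact: (far (fun l => - (c i N)^-1 * c i l)).
    by apply: si_memB => //; exact: (Ls _ (fun l => - (c i N)^-1 * c i l)).
  under eq_fun do rewrite big_ord_recr/=.
  have Lsi i : L (\sum_(l < N) c i l *: b l) by exact: Ls.
  apply: cauchy_alongD => //; first by move=> i; auto.
    apply: (IH c (M + M / d * nrm (b N))) => i.
    have := yM i; rewrite big_ord_recr/= => yMi.
    rewrite -[X in ip X X](addrK (c i N *: b N)).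
    rewrite (le_trans (nrmB _ _))//; auto; apply: lerD => //.
    by rewrite nrmZ// ler_wpM2r// nrm_ge0.
  move=> e e0; have K0 : 0 < nrm (b N) + 1 by rewrite ltr_pwDr// nrm_ge0.
  have [A FA hA] := ultra_bounded cM (divr_gt0 e0 K0).
  exists A => // i j Ai Aj; rewrite -scalerBl nrmZ//.
  rewrite (le_trans (ler_wpM2r (nrm_ge0 _) (hA _ _ Ai Aj)))//.
  by rewrite mulrAC ler_pdivrMr// ler_pM2l// lerDl.
apply: cauchy_along_approx => [i|e e0]; first exact: Ls.
have /choice[w wP] i : exists w : nat -> R,
    `|c i N| * nrm (b N - \sum_(l < N) w l *: b l) <= e.
  have K0 : 0 < `|c i N| + 1 by rewrite ltr_pwDr.
  have [w ww] : exists w : nat -> R, nrm (b N - \sum_(l < N) w l *: b l) < e / (`|c i N| + 1).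
    apply: contrapT => far; apply: close; exists (e / (`|c i N| + 1)).
      exact: divr_gt0.
    by move=> w; rewrite leNgt; apply/negP => ww; apply: far; exists w.
  exists w; rewrite (le_trans (ler_wpM2l _ (ltW ww)))//.
  by rewrite mulrCA ger_pMr// ler_pdivrMr// mul1r lerDl.
pose y i := \sum_(l < N) (c i l + c i N * w i l) *: b l.
have Ly i : L (y i) by exact: (Ls N (fun l => c i l + c i N * w i l)).
have Lw i : L (\sum_(l < N) w i l *: b l) by exact: Ls.
have LS i : L (\sum_(l < N.+1) c i l *: b l) by exact: Ls.
have xy i : nrm (\sum_(l < N.+1) c i l *: b l - y i) <= e.
  have -> : \sum_(l < N.+1) c i l *: b l - y i =
      c i N *: (b N - \sum_(l < N) w i l *: b l).
    rewrite big_ord_recr/= /y; under [X in _ - X]eq_bigr do rewrite scalerDl -scalerA.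
    by rewrite big_split/= -scaler_sumr scalerBr opprD addrACA subrr add0r.
  by rewrite nrmZ ?wP//; auto.
exists y; split => //; last by exists setT => //; exact: filterT.
apply: (IH (fun i l => c i l + c i N * w i l) (M + e)) => i; rewrite -[X in ip X X]/(y i).
rewrite -[X in ip X X](subKr (\sum_(l < N.+1) c i l *: b l)).
by rewrite (le_trans (nrmB _ _))//; auto; rewrite lerD ?yM ?xy.
Qed.

(** A set of indices that belongs to [F] is infinite, so that indices can be picked
    in increasing order from a decreasing sequence of such sets. *)
Lemma cauchy_along_subseq (x : nat -> E) : \oo `<=` F -> cauchy_along x ->
  exists2 phi : nat -> nat, {homo phi : i j / (i < j)%N} &
  forall e, 0 < e -> exists N, forall i j, (N <= i)%N -> (N <= j)%N ->
    nrm (x (phi i) - x (phi j)) <= e.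
Proof.
move=> ooF cx.
have /choice[A AP] i : exists A : set nat, F A /\
    forall j k, A j -> A k -> nrm (x j - x k) <= i.+1%:R^-1.
  have [A FA hA] := cx (i.+1%:R^-1) ltac:(by rewrite invr_gt0 ltr0n).
  by exists A.
pose B i := \bigcap_(j in [set j | (j <= i)%N]) A j.
have FB i : F (B i).
  elim: i => [|i IH].
    apply: (filterS _ (AP 0%N).1) => k Ak j /=; by rewrite leqn0 => /eqP ->.
  apply: (filterS _ (filterI IH (AP i.+1).1)) => k [Bk Ak] j /=.
  by rewrite leq_eqVlt => /predU1P[->//|]; exact: Bk.
have /choice[next nextP] (p : nat * nat) : exists k, (p.2 < k)%N /\ B p.1 k.
  have : F (B p.1 `&` [set k | (p.2 < k)%N]).
    apply: filterI; first exact: FB.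
    by apply: ooF; exact: nbhs_infty_gt.
  by move=> /filter_ex[k [Bk pk]]; exists k.
pose phi := fix phi i := if i is j.+1 then next (j.+1, phi j) else next (0, 0)%N.
have Bphi i : B i (phi i) by case: i => [|i]; [exact: (nextP (0, 0)%N).2 | exact: (nextP (i.+1, phi i)).2].
exists phi.
  apply: homo_ltn; first exact: ltn_trans.
  by move=> i /=; have [] := nextP (i.+1, phi i).
move=> e e0; have [N _ NP] := near_infty_natSinv_lt (PosNum e0).
exists N => i j Ni Nj; rewrite (le_trans _ (ltW (NP N _)))//=.
by apply: (AP N).2; [apply: (Bphi i) | apply: (Bphi j)].
Qed.

End ultra.

(** Sequences that are approximated by bounded sequences of finite dimension.  All
    the approximations are Cauchy along one and the same ultrafilter, which
    takes the place of a diagonal extraction. *)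
Lemma cauchy_subsequence (x : nat -> E) : (forall i, L (x i)) ->
  (forall e, 0 < e -> exists N (b : nat -> E) (c : nat -> nat -> R) M,
    [/\ forall l, L (b l), forall i, nrm (\sum_(l < N) c i l *: b l) <= M &
        forall i, nrm (x i - \sum_(l < N) c i l *: b l) <= e]) ->
  exists2 phi : nat -> nat, {homo phi : i j / (i < j)%N} &
  forall e, 0 < e -> exists N, forall i j, (N <= i)%N -> (N <= j)%N ->
    nrm (x (phi i) - x (phi j)) <= e.
Proof.
move=> Lx xapp.
have [F [UF ooF]] := @ultraFilterLemma nat \oo _.
apply: (@cauchy_along_subseq F) => //.
apply: cauchy_along_approx => // e /xapp[N [b [c [M [Lb cM xc]]]]].
exists (fun i => \sum_(l < N) c i l *: b l); split.
- by move=> i; exact: si_mem_sum.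
- exact: cauchy_along_span cM.
- by exists setT => //; exact: filterT.
Qed.

End semi_inner_theory.

(** * Completeness of the space of square integrable functions *)

Section square_integrable.
Context d (T : measurableType d) (R : realType) (mu : {measure set T -> \bar R}).
Implicit Types f g : T -> R.
Local Notation L2 := (Lfun mu 2%:E).

Lemma Lfun_measurable p f : f \in Lfun mu p -> measurable_fun setT f.
Proof. by move=> /andP[/[!inE]]. Qed.

Lemma Lfun2I f : measurable_fun setT f ->
  mu.-integrable setT (EFin \o (fun x => f x ^+ 2)) -> f \in L2.
Proof.
move=> mf /integrableP[_ intf]; rewrite inE; apply/andP; split; rewrite inE//=.
rewrite /finite_norm unlock poweR_lty//; apply: le_lt_trans intf.
rewrite le_eqVlt; apply/orP; left; apply/eqP; apply: eq_integral => x _ /=.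
by rewrite normrX powR_mulrn.
Qed.

Lemma Lfun2_integrableM f g : f \in L2 -> g \in L2 ->
  mu.-integrable setT (EFin \o (fun x => f x * g x)).
Proof. by move=> L2f L2g; apply/Lfun1_integrable; exact: Lfun2_mul_Lfun1. Qed.

Lemma Lfun2_linear a f g : f \in L2 -> g \in L2 -> a *: f + g \in L2.
Proof. exact: ((Lfun_submod_closed mu (lee1n 2)).2 a). Qed.

Lemma Lfun2_semi_inner :
  semi_inner [set f | f \in L2] (fun f g => \int[mu]_x (f x * g x)).
Proof.
split.
- exact: (Lfun_submod_closed mu (lee1n 2)).1.
- by move=> a f g; exact: Lfun2_linear.
- by move=> f g; apply: eq_Rintegral => x _; exact: mulrC.
- move=> a f g w /= Lf Lg Lw.
  rewrite -RintegralZl//; last exact: Lfun2_integrableM.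
  rewrite -RintegralD//; last 2 first.
  + have := integrableZl measurableT a (Lfun2_integrableM Lf Lw).
    by under eq_fun do rewrite -EFinM.
  + exact: Lfun2_integrableM.
  by apply: eq_Rintegral => x _; rewrite /= mulrDl mulrA.
- by move=> f; apply: Rintegral_ge0 => x _; rewrite -expr2 sqr_ge0.
Qed.

Lemma Lfun2_integral_sqr f : f \in L2 ->
  (\int[mu]_x (f x ^+ 2)%:E)%E = (\int[mu]_x (f x * f x))%:E.
Proof.
move=> L2f; rewrite /Rintegral fineK//.
by rewrite integrable_fin_num//; exact: Lfun2_integrableM.
Qed.

(** Square summability of the increments against the weights [4 ^+ k] forces
    geometric decay, hence convergence, of the increments themselves. *)
Lemma weighted_increments_cvg (y : nat -> R) :
  (\sum_(0 <= k <oo) (4 ^+ k * (y k.+1 - y k) ^+ 2)%:E < +oo)%E -> cvgn y.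
Proof.
move=> Hlt; set S := (\sum_(0 <= k <oo) _)%E in Hlt.
have t0 k : (0 <= (4 ^+ k * (y k.+1 - y k) ^+ 2)%:E)%E.
  by rewrite lee_fin mulr_ge0 ?sqr_ge0// exprn_ge0.
have S0 : (0 <= S)%E by apply: nneseries_ge0.
have incr k : `|y k.+1 - y k| <= geometric (Num.sqrt (fine S)) 2^-1 k.
  rewrite /= -(@ler_pXn2r _ 2)// ?nnegrE ?mulr_ge0 ?sqrtr_ge0 ?exprn_ge0//.
  rewrite exprMn sqr_sqrtr ?fine_ge0// real_normK ?num_real//.
  rewrite -exprM mulnC exprM exprVn -[X in X ^-1](_ : 4 = _); last by rewrite expr2; lra.
  rewrite exprVn ler_pdivlMr ?exprn_gt0// mulrC -lee_fin fineK ?ge0_fin_numE//.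
  rewrite /S (nneseriesD1 (n := k))//.
  by rewrite leeDl//; apply: nneseries_ge0.
have := @series_le_cvg _ (fun k => `|y k.+1 - y k|) _ (fun=> normr_ge0 _) _ incr _.
move=> /(_ _ _)/normed_cvg.
have -> : series (fun k => y k.+1 - y k) = (fun k => y k - y 0%N).
  by apply/funext => k; rewrite /series/= telescope_sumr.
move=> cv.
have -> : y = (fun k => y k - y 0%N) \+ cst (y 0%N).
  by apply/funext => k /=; rewrite subrK.
apply: is_cvgD; last exact: is_cvg_cst.
apply: cv => [k|]; first by rewrite mulr_ge0 ?sqrtr_ge0 ?exprn_ge0.
by apply: is_cvg_geometric_series; rewrite ger0_norm ?invf_lt1// ltr1n.
Qed.

(** The Riesz-Fischer theorem.  The subsequence [y] has increments [<= 8 ^- k] in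
    square norm, so the series of the weighted squares [4 ^+ k * (y k.+1 - y k) ^+ 2]
    is integrable, hence finite almost everywhere; Fatou's lemma bounds the
    distance to the pointwise limit. *)
Lemma Lfun2_complete (x : nat -> T -> R) : (forall i, x i \in L2) ->
  (forall e, 0 < e -> exists N, forall i j, (N <= i)%N -> (N <= j)%N ->
     \int[mu]_t ((x i t - x j t) * (x i t - x j t)) <= e) ->
  exists2 v, v \in L2 & forall e, 0 < e -> exists N, forall i, (N <= i)%N ->
     \int[mu]_t ((x i t - v t) * (x i t - v t)) <= e.
Proof.
move=> L2x cx.
have mx i : measurable_fun setT (x i) by apply: Lfun_measurable (L2x i).
have L2B f g : f \in L2 -> g \in L2 -> (fun t => f t - g t) \in L2.
  move=> Lf Lg; have -> : (fun t => f t - g t) = (-1) *: g + f.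
    by apply/funext => t /=; rewrite scaleN1r addrC.
  exact: Lfun2_linear.
have /choice[N NP] k : exists N, forall i j, (N <= i)%N -> (N <= j)%N ->
    \int[mu]_t ((x i t - x j t) * (x i t - x j t)) <= 8^-1 ^+ k.
  by apply: cx; rewrite exprn_gt0.
(* a nondecreasing majorant of [N] *)
pose nu k := (\sum_(j < k.+1) N j)%N.
have nuN k : (N k <= nu k)%N by rewrite /nu big_ord_recr/= leq_addl.
have nu_nd : {homo nu : i j / (i <= j)%N}.
  apply: homo_leq => [//|? ? ?|k]; first exact: leq_trans.
  by rewrite /nu [leqRHS]big_ord_recr/= leq_addr.
pose y k := x (nu k).
have my k : measurable_fun setT (y k) by exact: mx.
have yx k n i : (k <= n)%N -> (nu k <= i)%N ->
    (\int[mu]_t ((y n t - x i t) ^+ 2)%:E <= (8^-1 ^+ k)%:E)%E.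
  move=> kn ki; rewrite (Lfun2_integral_sqr (L2B _ _ (L2x (nu n)) (L2x i))).
  rewrite lee_fin; apply: NP; first exact: leq_trans (nuN k) (nu_nd _ _ kn).
  exact: leq_trans (nuN k) ki.
have mwt k : measurable_fun [set: T] (EFin \o (fun t => 4 ^+ k * (y k.+1 t - y k t) ^+ 2 : R)).
  apply/measurable_EFinP; apply: measurable_funM => //; apply: measurable_funX.
  exact: measurable_funB.
have wt0 k t : (0 <= (4 ^+ k * (y k.+1 t - y k t) ^+ 2)%:E)%E.
  by rewrite lee_fin mulr_ge0 ?sqr_ge0// exprn_ge0.
have intH : (\int[mu]_t \sum_(0 <= k <oo) (4 ^+ k * (y k.+1 t - y k t) ^+ 2)%:E < +oo)%E.
  rewrite integral_nneseries//.
  apply: (@le_lt_trans _ _ (\sum_(0 <= k <oo) (geometric 1 2^-1 k)%:E)%E).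
    apply: lee_nneseries => [k _ _|k _]; first by apply: integral_ge0 => t _; exact: wt0.
    under eq_integral do rewrite EFinM.
    rewrite ge0_integralZl ?lee_fin ?exprn_ge0//; last 2 first.
    - by apply/measurable_EFinP; apply: measurable_funX; exact: measurable_funB.
    - by move=> t _; rewrite lee_fin sqr_ge0.
    have p4 : (0 <= (4 ^+ k)%:E :> \bar R)%E by rewrite lee_fin exprn_ge0.
    apply: (le_trans (lee_wpmul2l p4 (yx k k.+1 (nu k) (leqnSn k) (leqnn _)))).
    rewrite /= mul1r -EFinM lee_fin -exprMn; apply: lerXn2r; rewrite ?nnegrE//; lra.
  have gc : (fun n => (series (geometric (1 : R) 2^-1) n)%:E) @ \oo --> (1 * (1 - 2^-1)^-1)%:E.
    apply: cvg_EFin; first by exact: nearW.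
    by apply: cvg_geometric_series; rewrite ger0_norm ?invf_lt1// ltr1n.
  rewrite (_ : limn _ = (1 * (1 - 2^-1)^-1)%:E) ?ltry//.
  apply/cvg_lim => //; move: gc; under eq_fun do rewrite /series/= -sumEFin.
  exact.
have aecvg : {ae mu, forall t, cvgn (y ^~ t)}.
  have intg : mu.-integrable setT
      (fun t => \sum_(0 <= k <oo) (4 ^+ k * (y k.+1 t - y k t) ^+ 2)%:E)%E.
    apply/integrableP; split.
      apply: (@ge0_emeasurable_sum _ _ _ _ (fun k t =>
        (4 ^+ k * (y k.+1 t - y k t) ^+ 2)%:E) xpredT) => [k t _ _|k _].
        exact: wt0.
      exact: mwt.
    by under eq_integral do (rewrite gee0_abs; last exact: nneseries_ge0).
  apply: filterS (integrable_ae measurableT intg) => t /(_ I) fint.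
  by apply: weighted_increments_cvg; rewrite -ge0_fin_numE//; exact: nneseries_ge0.
pose v t := fine (limn_esup (fun k => (y k t)%:E)).
have mv : measurable_fun setT v.
  apply: measurableT_comp => //; apply: measurable_fun_limn_esup => k.
  exact/measurable_EFinP.
have vx k i : (nu k <= i)%N ->
    (\int[mu]_t ((x i t - v t) ^+ 2)%:E <= (8^-1 ^+ k)%:E)%E.
  move=> ki.
  have mh n : measurable_fun [set: T] (EFin \o (fun t => (y n t - x i t) ^+ 2 : R)).
    by apply/measurable_EFinP; apply: measurable_funX; exact: measurable_funB.
  have -> : (\int[mu]_t ((x i t - v t) ^+ 2)%:E =
      \int[mu]_t limn_einf (fun n => ((y n t - x i t) ^+ 2)%:E))%E.
    apply: ae_eq_integral => //.
    - by apply/measurable_EFinP; apply: measurable_funX; exact: measurable_funB.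
    - apply: measurableT_comp => //; apply: measurable_fun_limn_esup => n.
      under eq_fun do rewrite -EFinN; apply/measurable_EFinP.
      apply: measurable_funN; apply: measurable_funX; exact: measurable_funB.
    apply: filterS aecvg => t cyt _.
    have cE : (fun n => (y n t)%:E) @ \oo --> (limn (y ^~ t))%:E.
      by apply: cvg_EFin => //; exact: nearW.
    have -> : v t = limn (y ^~ t).
      by rewrite /v is_cvg_limn_esupE; [rewrite (cvg_lim _ cE)|apply: cvgP cE].
    have c2 : (fun n => ((y n t - x i t) ^+ 2)%:E) @ \oo --> ((x i t - limn (y ^~ t)) ^+ 2)%:E.
      apply: cvg_EFin; first exact: nearW.
      rewrite -sqrrN opprB expr2; under eq_fun do rewrite expr2.
      by apply: cvgM; apply: cvgB => //; exact: cvg_cst.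
    by rewrite is_cvg_limn_einfE; [rewrite (cvg_lim _ c2)|apply: cvgP c2].
  apply: le_trans (fatou _ _ _ _) _ => //.
    by move=> n t _; rewrite lee_fin sqr_ge0.
  rewrite limn_einf_lim; apply: lime_le; first exact: is_cvg_einfs.
  exists k => // n /= kn; apply: le_trans (yx k n i kn ki).
  by apply: ereal_inf_lbound; exists n => //=.
have L2v : v \in L2.
  have : (fun t => x (nu 0%N) t - v t) \in L2.
    apply: Lfun2I; first exact: measurable_funB.
    apply/integrableP; split.
      by apply/measurable_EFinP; apply: measurable_funX; exact: measurable_funB.
    under eq_integral do rewrite gee0_abs ?lee_fin ?sqr_ge0//.
    by apply: (le_lt_trans (vx 0%N _ (leqnn _))); rewrite ltry.
  move=> /(L2B _ _ (L2x (nu 0%N))); rewrite (_ : (fun t => _) = v)//.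
  by apply/funext => t; rewrite subKr.
exists v => // e e0.
have [k _ kP] : \forall k \near \oo, `|8^-1 ^+ k| < e.
  have : (fun k => 8^-1 ^+ k : R) @ \oo --> 0.
    by apply: cvg_expr; rewrite ger0_norm ?invf_lt1// ltr1n.
  by move=> /cvgr0_norm_lt; apply.
exists (nu k) => i ki; rewrite (le_trans _ (ltW (kP k _)))//=.
rewrite (le_trans _ (ler_norm _))// -lee_fin -Lfun2_integral_sqr ?vx//.
exact: L2B.
Qed.

End square_integrable.

(** * Borel sets of row vectors *)

Section borel_rV.
Context {R : realType} {n : nat}.

Lemma ler_coord_norm (x : 'rV[R]_n) (i : 'I_n) : `|x 0 i| <= `|x|.
Proof.
rewrite [leRHS]mx_normrE; exact: (le_bigmax _ (fun ij : 'I_1 * 'I_n => `|x ij.1 ij.2|) (0, i)).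
Qed.

Lemma rV_norm_ltP (x : 'rV[R]_n) (e : R) : 0 < e ->
  (forall i, `|x 0 i| < e) -> `|x| < e.
Proof.
move=> e0 xe; rewrite [ltLHS]mx_normrE; apply/bigmax_ltP; split => //= -[i j] _ /=.
by rewrite (ord1 i).
Qed.

(** An open set is the union of the cubes [cell (m, c)], of side [1 / m.+1] and lower
    corner [c / m.+1], that it contains, and there are countably many of them. *)
Lemma open_rV_measurable (U : set 'rV[R]_n) : open U -> measurable U.
Proof.
move=> oU.
pose cell (p : nat * 'rV[int]_n) : set 'rV[R]_n :=
  \bigcap_(i in [set: 'I_n]) [set x | (p.2 0 i)%:~R <= p.1.+1%:R * x 0 i < (p.2 0 i + 1)%:~R].
have mcell p : measurable (cell p).
  apply: fin_bigcap_measurable => [|i _]; first exact: finite_finset.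
  rewrite [X in measurable X](_ : _ = (fun x : 'rV[R]_n => x 0 i) @^-1`
     `[(p.2 0 i)%:~R / p.1.+1%:R, (p.2 0 i + 1)%:~R / p.1.+1%:R[%classic); last first.
    apply/seteqP; split => x /=;
      by rewrite in_itv/= ler_pdivrMr ?ltr0n// ltr_pdivlMr ?ltr0n// (mulrC (x 0 i)).
  by rewrite -[X in measurable X]setTI; apply: measurable_rVcoord => //; exact: measurable_itv.
have -> : U = \bigcup_(p in [set p | cell p `<=` U]) cell p.
  apply/seteqP; split => [x Ux|x [p pU] /pU//].
  have /nbhs_ballP[e /= e0 xeU] : nbhs x U by apply: open_nbhs_nbhs.
  have [m _ /(_ m (leqnn m)) /= me] := near_infty_natSinv_lt (PosNum e0).
  exists (m, \row_i Num.floor (m.+1%:R * x 0 i)) => /=.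
    move=> y cy; apply: xeU; rewrite mx_norm_ball /ball_/=.
    apply: rV_norm_ltP => // i; apply: lt_trans me.
    have := cy i I; rewrite /= !mxE.
    have := floor_itv (m.+1%:R * x 0 i).
    set f := Num.floor _; rewrite intrD => /andP[x1 x2] /andP[y1 y2].
    have m0 : 0 < m.+1%:R :> R by rewrite ltr0n.
    rewrite -[ltRHS]mul1r ltr_pdivlMr// -[X in _ * X](gtr0_norm m0) -normrM.
    by rewrite ltr_norml mulrBl ![_ * m.+1%:R]mulrC; apply/andP; split; lra.
  move=> i _ /=; rewrite mxE; have := floor_itv (m.+1%:R * x 0 i).
  by rewrite intrD.
rewrite bigcup_mkcond; apply: countable_bigcupT_measurable => [|p].
  exact: countableP.
by case: ifP.
Qed.

Lemma continuous_rV_measurable (f : 'rV[R]_n -> R) : continuous f ->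
  measurable_fun setT f.
Proof.
move=> /continuousP cf; apply: (measurability _ (RGenOpens.measurableE R)).
move=> _ [_ [a [b ->] <-]]; rewrite setTI; apply: open_rV_measurable.
exact/cf/interval_open.
Qed.
End borel_rV.

(** * Directional derivatives *)

Section directional.
Context {R : realType}.

(** This moves derivatives between a function of several variables, its restrictions
    to lines and its restrictions to coordinate hyperplanes. *)
Lemma is_derive_line (V W : normedModType R) (f : V -> R) (g : W -> R)
    a v b w (l : R) :
  (forall t : R, g (t *: w + b) = f (t *: v + a)) ->
  is_derive a v f l -> is_derive b w g l.
Proof.
move=> gf [df fl]; have gfa : g b = f a by have := gf 0; rewrite !scale0r !add0r.
have E : (fun t : R => t^-1 *: (g (t *: w + b) - g b)) =
    (fun t : R => t^-1 *: (f (t *: v + a) - f a)).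
  by apply/funext => t; rewrite gf gfa.
by split; [rewrite /derivable E | rewrite /derive E].
Qed.

Lemma partial_line n (f : 'rV[R]_n -> R) (i : 'I_n) (x : 'rV[R]_n) (t : R) :
  derivable f (t *: delta_mx 0 i + x) (delta_mx 0 i) ->
  is_derive t 1 (fun t : R => f (t *: delta_mx 0 i + x))
    (partial i f (t *: delta_mx 0 i + x)).
Proof.
move=> df; apply: is_derive_line (derivableP df) => r.
by rewrite scalerDl addrA [r *: 1]mulr1.
Qed.

Lemma continuous_derivable (f g : R -> R) :
  (forall t : R, is_derive t 1 f (g t)) -> continuous f.
Proof.
move=> df t; apply: differentiable_continuous; apply/derivable1_diffP.
exact: (@ex_derive _ _ _ _ _ _ _ (df t)).
Qed.

Definition mixed_diff n (f : 'rV[R]_n -> R) (u v x : 'rV[R]_n) : R :=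
  f (u + (v + x)) - f (u + x) - (f (v + x) - f x).

Lemma mixed_diffC n (f : 'rV[R]_n -> R) u v x :
  mixed_diff f u v x = mixed_diff f v u x.
Proof.
rewrite /mixed_diff (addrCA u v x).
by rewrite !opprB addrACA [- f (u + x) - _]addrC addrACA.
Qed.

(** The mixed second difference is [h ^+ 2] times a mixed partial derivative at a
    point nearby, by two applications of the mean value theorem. *)
Lemma mixed_diff_mvt n (f : 'rV[R]_n -> R) (i j : 'I_n) (x : 'rV[R]_n) (h : R) :
  0 < h ->
  (forall y, derivable f y (delta_mx 0 i)) ->
  (forall y, derivable (partial i f) y (delta_mx 0 j)) ->
  exists2 y : 'rV[R]_n,
    `|x - y| <= h * (`|delta_mx 0 i : 'rV[R]_n| + `|delta_mx 0 j : 'rV[R]_n|) &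
    mixed_diff f (h *: delta_mx 0 i) (h *: delta_mx 0 j) x =
      h ^+ 2 * partial j (partial i f) y.
Proof.
move=> h0 dif djf; rewrite /mixed_diff.
move: dif djf; set ei := delta_mx 0 i; set ej := delta_mx 0 j => dif djf.
pose phi (t : R) := f (t *: ei + (h *: ej + x)) - f (t *: ei + x).
pose phi' (t : R) := partial i f (t *: ei + (h *: ej + x)) - partial i f (t *: ei + x).
have dphi (t : R) : is_derive t 1 phi (phi' t).
  by apply: is_deriveB; exact: partial_line.
have [|a] := MVT h0 (fun t _ => dphi t).
  by apply: continuous_subspaceT; exact: continuous_derivable dphi.
rewrite in_itv/= => /andP[a0 ah] phiE.
pose psi (t : R) := partial i f (t *: ej + (a *: ei + x)).
pose psi' (t : R) := partial j (partial i f) (t *: ej + (a *: ei + x)).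
have dpsi (t : R) : is_derive t 1 psi (psi' t) by exact: partial_line.
have [|b] := MVT h0 (fun t _ => dpsi t).
  by apply: continuous_subspaceT; exact: continuous_derivable dpsi.
rewrite in_itv/= => /andP[b0 bh] psiE.
exists (b *: ej + (a *: ei + x)).
  rewrite addrA opprD addrCA subrr addr0 normrN.
  rewrite (le_trans (ler_normD _ _))// !normrZ !gtr0_norm// mulrDr addrC.
  by rewrite lerD// ler_wpM2r// ltW.
move: phiE; rewrite /phi !scale0r !add0r !subr0 => ->.
move: psiE; rewrite /psi /psi' !scale0r !add0r !subr0 => psiE.
by rewrite /phi' addrCA psiE -mulrA mulrC expr2.
Qed.

(** Schwarz's theorem: the mixed second difference is symmetric in the two
    directions, so the two mixed derivatives agree at points arbitrarily close to
    [x], and they are continuous. *)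
Lemma partialC n (f : 'rV[R]_n -> R) (i j : 'I_n) (x : 'rV[R]_n) :
  (forall i y, derivable f y (delta_mx 0 i)) ->
  (forall i j y, derivable (partial i f) y (delta_mx 0 j)) ->
  (forall i j, {for x, continuous (partial i (partial j f))}) ->
  partial i (partial j f) x = partial j (partial i f) x.
Proof.
move=> df ddf cddf; apply/eqP; rewrite -subr_eq0 -normr_le0.
apply/ler_addgt0Pr => e e0; rewrite add0r.
have e20 : 0 < e / 2 by rewrite divr_gt0.
have tri (a b c : R) : `|a - c| < e / 2 -> `|b - c| < e / 2 -> `|a - b| <= e.
  move=> ac bc; rewrite [e]splitr (le_trans (ler_distD c _ _))//.
  by rewrite lerD ?(ltW ac)// distrC ltW.
have near_x k l : exists2 r, 0 < r & forall y, `|x - y| < r ->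
    `|partial k (partial l f) x - partial k (partial l f) y| < e / 2.
  have /cvgrPdist_lt/(_ _ e20)/nbhs_ballP[r r0 rP] := cddf k l.
  by exists r => // y xy; apply: rP; rewrite mx_norm_ball.
have [r1 r10 r1P] := near_x i j; have [r2 r20 r2P] := near_x j i.
pose K : R := `|delta_mx 0 i : 'rV[R]_n| + `|delta_mx 0 j : 'rV[R]_n| + 1.
have K0 : 0 < K by rewrite ltr_pwDr// addr_ge0.
pose r := Num.min r1 r2.
have r0 : 0 < r by rewrite lt_min r10.
pose h := r / K.
have h0 : 0 < h by rewrite divr_gt0.
have small d : d <= h * (K - 1) -> d < r1 /\ d < r2.
  move=> dh; apply/andP; rewrite -lt_min -/r (le_lt_trans dh)// mulrBr mulr1.
  by rewrite /h divfK ?gt_eqF// gtrDl oppr_lt0.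
have [y yx E1] := mixed_diff_mvt x h0 (df i) (ddf i j).
have [z zx E2] := mixed_diff_mvt x h0 (df j) (ddf j i).
have yzE : partial j (partial i f) y = partial i (partial j f) z.
  have h2 : h ^+ 2 != 0 by rewrite expf_neq0// gt_eqF.
  exact: (mulfI h2 (etrans (esym E1) (etrans (mixed_diffC f _ _ x) E2))).
have [|_ /r2P q2] := small `|x - y|; first by rewrite /K addrK.
have [|/r1P q1 _] := small `|x - z|; first by rewrite /K addrK [X in _ * X]addrC.
rewrite -yzE in q1.
exact: tri q1 q2.
Qed.

End directional.

(** * The integral of a partial derivative *)

Section compactly_supported.
Context {R : realType}.

Definition cube n (M : R) : set 'rV[R]_n := [set x | forall i, x 0 i \in `[- M, M]].

Arguments cube : clear implicits.

Lemma compact_cube n M : compact (cube n M).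
Proof. by apply: (@rV_compact _ _ (fun=> `[- M, M]%classic)) => i; exact: segment_compact. Qed.

Lemma measurable_cube n M : measurable (cube n M).
Proof.
rewrite (_ : cube n M = \bigcap_(i in [set: 'I_n]) ((fun x : 'rV[R]_n => x 0 i) @^-1` `[- M, M]%classic)); last first.
  by apply/seteqP; split => x /= cx i; [move=> _|]; exact: (cx i).
apply: fin_bigcap_measurable => [|i _]; first exact: finite_finset.
by rewrite -[X in measurable X]setTI; apply: measurable_rVcoord => //; exact: measurable_itv.
Qed.

Lemma lebesgue_cube_lty n M : (lebesgue_rV n (cube n M) < +oo)%E.
Proof.
elim: n => [|n IH] /=; first by rewrite diracE ltry.
rewrite /lebesgue_step /pushforward.
have -> : @rVcons R n @^-1` cube n.+1 M = `[- M, M]%classic `*` cube n M.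
  apply/seteqP; split => -[t x] /=.
    move=> cx; split => [|j].
      by have := cx 0; rewrite mxE unlift_none.
    by have := cx (lift 0 j); rewrite mxE liftK.
  move=> [ct cx] i; rewrite mxE; by case: unliftP => [j _|_] /=.
rewrite product_measure1E//; last exact: measurable_cube.
rewrite lte_mul_pinfty ?measure_ge0// ?lebesgue_measure_itv//=.
by have := @lebesgue_measure_itv R `[- M, M]; case: ifP => _ ->; rewrite -?EFinB.
Qed.

Definition cc_supported n (f : 'rV[R]_n -> R) :=
  continuous f /\ exists M, forall x, ~ cube n M x -> f x = 0.

Lemma cc_supported_integrable n (f : 'rV[R]_n -> R) : cc_supported f ->
  (lebesgue_rV n).-integrable setT (EFin \o f).
Proof.
move=> [cf [M fM]].
have mf := continuous_rV_measurable cf.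
have -> : EFin \o f = (EFin \o f) \_ (cube n M).
  apply/funext => x; rewrite /patch; case: ifPn => //.
  by rewrite notin_setE => xc; rewrite /= fM.
have mc := @measurable_cube n M.
apply/(integrable_mkcond _ mc).
apply: measurable_bounded_integrable => //.
- exact: lebesgue_cube_lty.
- exact: measurable_funTS.
have [B [Breal fB]] : bounded_set (f @` cube n M).
  apply: compact_bounded; apply: continuous_compact; last exact: compact_cube.
  exact: continuous_subspaceT.
by exists B; split => // B' BB' x cx; apply: fB => //; exists x.
Qed.

(** The fundamental theorem of calculus on an interval whose end points lie outside
    the support. *)
Lemma integral_derive0 (F G : R -> R) (M : R) : continuous G ->
  (forall t : R, is_derive t 1 F (G t)) ->
  (forall t, t \notin `[- M, M] -> F t = 0) ->
  (forall t, t \notin `[- M, M] -> G t = 0) ->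
  (\int[lebesgue_measure]_t (G t)%:E = 0)%E.
Proof.
move=> cG dF F0 G0.
(* [M] may be negative, and [F] may be nonzero at [M] *)
pose N := `|M| + 1.
have N0 : 0 < N by rewrite ltr_pwDr.
have out t : N <= `|t| -> t \notin `[- M, M].
  move=> Nt; rewrite in_itv/= -ler_norml -ltNge.
  by rewrite (le_lt_trans (ler_norm M))// (lt_le_trans _ Nt)// ltrDl.
have cF := continuous_derivable dF.
have -> : (fun t => (G t)%:E) = (fun t => (G t)%:E) \_ `[- N, N].
  apply/funext => t; rewrite /patch; case: ifPn => //; rewrite notin_setE/= => tN.
  by rewrite G0// out//; move/negP: tN; rewrite in_itv/= -ler_norml -ltNge => /ltW.
rewrite -integral_mkcond (@continuous_FTC2 _ G F)//.
- by rewrite !F0 ?out ?normrN ?gtr0_norm// subee.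
- by rewrite gtrN.
- exact: continuous_subspaceT.
- split => [t _||].
  + exact: (@ex_derive _ _ _ _ _ _ _ (dF t)).
  + by apply: cvg_at_right_filter; exact: cF.
  + by apply: cvg_at_left_filter; exact: cF.
- by move=> t _; rewrite derive1E (@derive_val _ _ _ _ _ _ _ (dF t)).
Qed.

Lemma rVcons_line0 n (t r : R) (x : 'rV[R]_n) :
  rVcons (t + r, x) = t *: delta_mx 0 0 + rVcons (r, x).
Proof.
apply/rowP => i; rewrite !mxE; case: unliftP => [j ->|->] /=.
  by rewrite mulr0 add0r.
by rewrite mulr1.
Qed.

Lemma rVcons_line n (t r : R) (x : 'rV[R]_n) (j : 'I_n) :
  rVcons (r, t *: delta_mx 0 j + x) = t *: delta_mx 0 (lift 0 j) + rVcons (r, x).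
Proof.
apply/rowP => i; rewrite !mxE; case: unliftP => [k ->|->] /=.
  by rewrite !mxE (inj_eq (@lift_inj _ _)).
by rewrite mulr0 add0r.
Qed.

Lemma continuous_rVcons n : continuous (@rVcons R n).
Proof.
move=> [r x]; apply/cvgrPdist_lt => e e0.
exists (ball r e, ball x e) => /=; first by split; exact: nbhsx_ballx.
move=> [r' x'] [/= rr']; rewrite mx_norm_ball /ball_/= => xx'.
apply: rV_norm_ltP => // i; rewrite !mxE; case: unliftP => [j _|_] //=.
by apply: le_lt_trans xx'; have := ler_coord_norm (x - x') j; rewrite !mxE.
Qed.

Lemma continuous_rVcons_r n (r : R) : continuous (fun x : 'rV[R]_n => rVcons (r, x)).
Proof.
move=> x A /(continuous_rVcons)[[B C] [/= nB nC] BCA].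
by apply: filterS nC => y Cy; apply: BCA; split => //; exact: nbhs_singleton.
Qed.

Lemma continuous_rVcons_l n (x : 'rV[R]_n) : continuous (fun r : R => rVcons (r, x)).
Proof.
move=> r A /(continuous_rVcons)[[B C] [/= nB nC] BCA].
by apply: filterS nB => y By; apply: BCA; split => //; exact: nbhs_singleton.
Qed.

(** The integral of a partial derivative vanishes: Fubini's theorem reduces this
    to the fundamental theorem of calculus along the lines parallel to one axis. *)
Lemma integral_partial0 n (i : 'I_n) (F G : 'rV[R]_n -> R) :
  cc_supported F -> cc_supported G ->
  (forall x, is_derive x (delta_mx 0 i) F (G x)) ->
  (\int[lebesgue_rV n]_x (G x)%:E = 0)%E.
Proof.
elim: n => [|n IH] in i F G *; first by case: i.
move=> [cF [MF FM]] ccG dFG; have [cG [MG GM]] := ccG.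
pose M := Num.max MF MG.
have {}FM x : ~ cube n.+1 M x -> F x = 0.
  move=> ncx; apply: FM => cx; apply: ncx => j; have := cx j.
  by rewrite !in_itv/= -!ler_norml => /le_trans; apply; rewrite le_max lexx.
have {}GM x : ~ cube n.+1 M x -> G x = 0.
  move=> ncx; apply: GM => cx; apply: ncx => j; have := cx j.
  by rewrite !in_itv/= -!ler_norml => /le_trans; apply; rewrite le_max lexx orbT.
have cc_slice H r : continuous H -> (forall x, ~ cube n.+1 M x -> H x = 0) ->
    cc_supported (fun x : 'rV[R]_n => H (rVcons (r, x))).
  move=> cH HM; split.
    move=> x; apply: (@continuous_comp _ _ _ (fun x => rVcons (r, x)) H); last exact: cH.
    exact: continuous_rVcons_r.
  exists M => x ncx; apply: HM => cx; apply: ncx => j.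
  by have := cx (lift 0 j); rewrite mxE liftK.
have mG : measurable_fun setT (EFin \o G).
  by apply/measurable_EFinP; exact: continuous_rV_measurable.
(* The Lebesgue measure on the line lives on another, convertible, copy of [R]. *)
have mrV : measurable_fun [set: measurableTypeR R * 'rV[R]_n] (@rVcons R n).
  exact: measurable_rVcons.
have mGc := measurableT_comp mG mrV.
have intGc : (lebesgue_measure \x lebesgue_rV n)%E.-integrable setT ((EFin \o G) \o @rVcons R n).
  have /integrableP[_ intG] := cc_supported_integrable ccG.
  apply/integrableP; split => //.
  move: intG; rewrite /= /lebesgue_step ge0_integral_pushforward//.
  exact: (measurableT_comp (@abse_measurable R setT) mG).
have -> : (\int[lebesgue_rV n.+1]_x (G x)%:E =
    \int[(lebesgue_measure \x lebesgue_rV n)%E]_p (EFin \o (G \o @rVcons R n)) p)%E.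
  have intG' : (lebesgue_measure \x lebesgue_rV n)%E.-integrable
      (@rVcons R n @^-1` setT) ((EFin \o G) \o @rVcons R n) by rewrite preimage_setT.
  have E := integral_pushforward mrV mG intG' measurableT.
  by rewrite preimage_setT in E; exact: E.
case: (unliftP 0 i) => [j ij|i0].
  rewrite -integral12_prod_meas1//; apply: integral0_eq => r _.
  apply: (IH j (fun x => F (rVcons (r, x)))) => [||x]; [exact: cc_slice|exact: cc_slice|].
  by apply: is_derive_line (dFG (rVcons (r, x))) => t; rewrite rVcons_line ij.
rewrite -integral21_prod_meas1//; apply: integral0_eq => x _.
apply: (@integral_derive0 (fun r => F (rVcons (r, x))) _ M) => [||r rM|r rM].
- move=> r; apply: (@continuous_comp _ _ _ (fun r => rVcons (r, x)) G); last exact: cG.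
  exact: continuous_rVcons_l.
- move=> r; apply: is_derive_line (dFG (rVcons (r, x))) => t.
  by rewrite i0 -rVcons_line0 [t *: 1]mulr1.
- by apply: FM => cx; move/negP: rM; apply; have := cx 0; rewrite mxE unlift_none.
- by apply: GM => cx; move/negP: rM; apply; have := cx 0; rewrite mxE unlift_none.
Qed.

End compactly_supported.

(** * Test functions *)

Section test_functions.
Context {R : realType} {n : nat}.
Implicit Types (Omega : set 'rV[R]_n) (f g : 'rV[R]_n -> R) (i j : 'I_n).
Local Notation leb := (@lebesgue_rV R n).

Lemma compact_sub_cube (K : set 'rV[R]_n) : compact K -> exists M, K `<=` @cube R n M.
Proof.
move=> /compact_bounded[M [Mreal KM]]; exists (M + 1) => x Kx i.
rewrite in_itv/= -ler_norml (le_trans (ler_coord_norm x i))//.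
by apply: KM => //; rewrite ltrDl.
Qed.

Lemma test_continuous Omega f : test_function Omega f -> continuous f.
Proof. by move=> [sf _] x; exact: (sf [::] x I).1. Qed.

Lemma test_derivable Omega f i x : test_function Omega f ->
  is_derive x (delta_mx 0 i) f (partial i f x).
Proof. by move=> [sf _]; apply: derivableP; exact: (sf [::] x I).2. Qed.

Lemma test_out Omega f x : test_function Omega f -> ~ Omega x -> f x = 0.
Proof. by move=> [_ [K [_ KO f0]]] nOx; apply: f0 => /KO. Qed.

Lemma test_cc_supported Omega f : test_function Omega f -> cc_supported f.
Proof.
move=> tf; split; first exact: test_continuous tf.
have [_ [K [/compact_sub_cube[M KM] _ f0]]] := tf.
by exists M => x nMx; apply: f0 => /KM.
Qed.

Lemma test_partial Omega f i : test_function Omega f ->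
  test_function Omega (partial i f).
Proof.
move=> [sf [K [cK KO f0]]]; split.
  move=> s x _; have := sf (rcons s i) x I.
  by rewrite /partials foldr_rcons.
exists K; split => // x nKx.
rewrite /partial (@near_eq_derive _ _ _ f (cst 0)) ?derive_cst//.
have : open_nbhs x (~` K).
  by split => //; apply: closed_openC; apply: compact_closed => //; exact: norm_hausdorff.
move=> /open_nbhs_nbhs; apply: filterS => y nKy; exact: f0.
Qed.

Lemma test_partialC Omega f i j : test_function Omega f ->
  partial i (partial j f) = partial j (partial i f).
Proof.
move=> [sf _]; apply/funext => x; apply: partialC.
- by move=> k y; exact: (sf [::] y I).2.
- by move=> k l y; exact: (sf [:: k] y I).2.
- by move=> k l; exact: (sf [:: k; l] x I).1.
Qed.

(** Test functions vanish outside [Omega], so that integrals over [Omega] become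
    integrals over the whole space, where Fubini's theorem applies. *)
Lemma Rintegral_supported Omega f : (forall x, ~ Omega x -> f x = 0) ->
  \int[leb]_(x in Omega) f x = \int[leb]_x f x.
Proof.
move=> f0; rewrite Rintegral_mkcond; apply: eq_Rintegral => x _.
by rewrite /patch; case: ifPn => //; rewrite notin_setE => /f0.
Qed.

Lemma cc_supportedM f g : cc_supported f -> continuous g -> cc_supported (f * g).
Proof.
move=> [cf [M fM]] cg; split; first by move=> x; exact: (cvgM (cf x) (cg x)).
by exists M => x /fM fx0; rewrite /= fctE fx0 mul0r.
Qed.

Lemma cc_supportedD f g : cc_supported f -> cc_supported g -> cc_supported (f + g).
Proof.
move=> [cf [M fM]] [cg [N gN]]; split.
  by move=> x; exact: (cvgD (cf x) (cg x)).
have sub (M1 M2 : R) x : M1 <= M2 -> @cube R n M1 x -> @cube R n M2 x.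
  move=> M12 cx i; have := cx i; rewrite !in_itv/= -!ler_norml => /le_trans; exact.
exists (Num.max M N) => x ncx; rewrite fctE fM ?gN ?addr0//.
  by move=> cx; apply: ncx; apply: sub cx; rewrite le_max lexx orbT.
by move=> cx; apply: ncx; apply: sub cx; rewrite le_max lexx.
Qed.

Lemma Rintegral_test_partial Omega f i : test_function Omega f ->
  \int[leb]_(x in Omega) partial i f x = 0.
Proof.
move=> tf; have tdf := test_partial i tf.
rewrite Rintegral_supported; last by move=> x; exact: test_out tdf.
have E : (\int[leb]_x (partial i f x)%:E = 0)%E; last by rewrite /Rintegral E.
apply: (@integral_partial0 _ _ i f).
- exact: test_cc_supported tf.
- exact: test_cc_supported tdf.
- by move=> x; exact: test_derivable tf.
Qed.

(** By the product rule, the sum of the two integrands is a partial derivative. *)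
Lemma test_ibp Omega f g i : test_function Omega f -> test_function Omega g ->
  \int[leb]_(x in Omega) (partial i f x * g x) =
  - \int[leb]_(x in Omega) (f x * partial i g x).
Proof.
move=> tf tg; have tdf := test_partial i tf; have tdg := test_partial i tg.
have cf := test_continuous tf; have cg := test_continuous tg.
have ccf := test_cc_supported tf; have ccdf := test_cc_supported tdf.
have cdg := test_continuous tdg.
have c1 := cc_supportedM ccdf cg; have c2 := cc_supportedM ccf cdg.
rewrite (@Rintegral_supported Omega (fun x => partial i f x * g x)); last first.
  by move=> x nOx; rewrite (test_out tdf)// mul0r.
rewrite (@Rintegral_supported Omega (fun x => f x * partial i g x)); last first.
  by move=> x nOx; rewrite (test_out tf)// mul0r.
apply/eqP; rewrite -addr_eq0 -RintegralD//; last 2 first.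
- exact: cc_supported_integrable c1.
- exact: cc_supported_integrable c2.
have -> : (fun x => partial i f x * g x + f x * partial i g x) =
    partial i f * g + f * partial i g by [].
have E : (\int[leb]_x ((partial i f * g + f * partial i g) x)%:E = 0)%E; last first.
  by rewrite /Rintegral E.
apply: (@integral_partial0 _ _ i (f * g)).
- exact: cc_supportedM.
- exact: cc_supportedD.
- move=> x; have D := is_deriveM (test_derivable i x tf) (test_derivable i x tg).
  apply: (is_derive_eq D); rewrite addrC.
  by congr (_ + _); exact: mulrC.
Qed.

Lemma cc_supported_Lfun2 f : cc_supported f -> f \in Lfun leb 2%:E.
Proof.
move=> ccf; apply: Lfun2I; first by case: ccf => /continuous_rV_measurable.
have := cc_supported_integrable (cc_supportedM ccf ccf.1).
by apply: eq_integrable => // x _; rewrite /= fctE expr2.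
Qed.

Lemma test_Lfun2 Omega f : test_function Omega f ->
  patch (cst 0) Omega f \in Lfun leb 2%:E.
Proof.
move=> tf; have -> : patch (cst 0) Omega f = f.
  apply/funext => x; rewrite /patch; case: ifPn => //.
  by rewrite notin_setE => /(test_out tf) ->.
exact/cc_supported_Lfun2/(test_cc_supported tf).
Qed.

End test_functions.

(** * The space of square integrable forms *)

Lemma integrable_Rintegral_sum d (T : measurableType d) (R : realType)
    (mu : {measure set T -> \bar R}) (I : Type) (r : seq I) (P : pred I) (F : I -> T -> R) :
  (forall i, mu.-integrable setT (EFin \o F i)) ->
  mu.-integrable setT (EFin \o (fun x => \sum_(i <- r | P i) F i x)) /\
  \int[mu]_x (\sum_(i <- r | P i) F i x) = \sum_(i <- r | P i) \int[mu]_x F i x.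
Proof.
move=> intF; elim: r => [|i r [IHi IHe]].
  rewrite big_nil; under eq_fun do rewrite big_nil; split.
    exact: integrable0.
  by rewrite Rintegral_cst// mul0r.
rewrite big_cons; under eq_fun do rewrite big_cons.
case: ifP => _ //; split; last by rewrite RintegralD// IHe.
exact: (integrableD measurableT (intF i) IHi).
Qed.

Lemma Lfun2_patch d (T : measurableType d) (R : realType)
    (mu : {measure set T -> \bar R}) (D : set T) (f : T -> R) : measurable D ->
  f \in Lfun mu 2%:E -> patch (cst 0) D f \in Lfun mu 2%:E.
Proof.
move=> mD L2f; apply: Lfun2I.
  apply: (measurable_restrictT f mD).1; apply: measurable_funTS.
  exact: Lfun_measurable L2f.
have := integrableS measurableT mD (@subsetT _ D) (Lfun2_integrable_sqr L2f).
move/(integrable_mkcond _ mD); apply: eq_integrable => // x _.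
rewrite /patch /=; case: ifP => xD //=.
by rewrite expr0n.
Qed.

Section L2_forms.
Context {R : realType} {n : nat} (Omega : set 'rV[R]_n).
Implicit Types (u v w z : dform R n) (A B : {set 'I_n}) (f g : 'rV[R]_n -> R).
Local Notation leb := (@lebesgue_rV R n).
Local Notation coef u A := (patch (cst 0) Omega (fun x => u x A)).
Local Notation nrm := (l2norm Omega).
Hypothesis mO : measurable Omega.

Definition L2form u := forall A, coef u A \in Lfun leb 2%:E.

Lemma L2Lambda_L2form k u : L2Lambda Omega k u -> L2form u.
Proof. by move=> uk A; exact: (uk A).1. Qed.

Lemma dform_linE a u v x A : (a *: u + v) x A = a * u x A + v x A.
Proof. by have -> : (a *: u + v) x = a *: u x + v x by []; rewrite !ffunE. Qed.

Lemma dform_subE u v x A : (u - v) x A = u x A - v x A.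
Proof. by have -> : (u - v) x = u x - v x by []; rewrite !ffunE. Qed.

Lemma coef_linear a u v A : coef (a *: u + v) A = a *: coef u A + coef v A.
Proof.
apply/funext => x.
change (patch (cst 0) Omega (fun x => (a *: u + v) x A) x =
  a * coef u A x + coef v A x).
rewrite /patch; case: ifP => _; first exact: dform_linE.
by rewrite mulr0 addr0.
Qed.

Lemma L2form_lin a u v : L2form u -> L2form v -> L2form (a *: u + v).
Proof. by move=> uL vL A; rewrite coef_linear; exact: Lfun2_linear. Qed.

Lemma inner_coef u v : L2form u -> L2form v ->
  inner Omega u v = \sum_A \int[leb]_x (coef u A x * coef v A x).
Proof.
move=> uL vL; have [_ <-] := @integrable_Rintegral_sum _ _ _ leb _
  (index_enum {set 'I_n}) xpredT _ (fun A => Lfun2_integrableM (uL A) (vL A)).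
rewrite /inner Rintegral_mkcond; apply: eq_Rintegral => x _.
rewrite /patch; case: ifP => _ //.
by rewrite big1// => A _; rewrite mulr0.
Qed.

Lemma inner_semi : semi_inner L2form (inner Omega).
Proof.
have S := Lfun2_semi_inner leb; split.
- move=> A; rewrite (_ : patch _ _ _ = 0); first exact: (si_mem0 S).
  by apply/funext => x; rewrite /patch; case: ifP => //; rewrite ffunE.
- exact: L2form_lin.
- by move=> u v; apply: eq_Rintegral => x _; apply: eq_bigr => A _; exact: mulrC.
- move=> a u v w uL vL wL; rewrite !inner_coef//; last exact: L2form_lin.
  rewrite mulr_sumr -big_split/=; apply: eq_bigr => A _; rewrite coef_linear.
  exact: (si_linl S a (uL A) (vL A) (wL A)).
- move=> u; apply: Rintegral_ge0 => x _; apply: sumr_ge0 => A _.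
  by rewrite -expr2 sqr_ge0.
Qed.

Lemma coef_norm_le u A : L2form u ->
  \int[leb]_x (coef u A x * coef u A x) <= inner Omega u u.
Proof.
move=> uL; rewrite inner_coef// (bigD1 A)//= lerDl; apply: sumr_ge0 => B _.
by apply: Rintegral_ge0 => x _; rewrite -expr2 sqr_ge0.
Qed.

Lemma L2Lambda0 k : L2Lambda Omega k 0.
Proof.
move=> A; split; first exact: (si_mem0 inner_semi).
by move=> _; apply: nearW => x _; rewrite ffunE.
Qed.

Lemma L2Lambda_lin k a u v : L2Lambda Omega k u -> L2Lambda Omega k v ->
  L2Lambda Omega k (a *: u + v).
Proof.
move=> uk vk A; split.
  by apply: L2form_lin; apply: L2Lambda_L2form; eassumption.
move=> Ak; apply: filterS2 ((uk A).2 Ak) ((vk A).2 Ak) => x u0 v0 Ox.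
by rewrite dform_linE u0// v0// addr0 mulr0.
Qed.

Lemma inner_ae0l u v : {ae leb, forall x, Omega x -> forall A, u x A * v x A = 0} ->
  L2form u -> L2form v -> inner Omega u v = 0.
Proof.
move=> uv0 uL vL; rewrite inner_coef// big1// => A _.
rewrite /Rintegral (_ : (\int[leb]_x _)%E = 0%E)//.
rewrite (@ae_eq_integral _ _ _ leb setT (cst 0%E))//; first exact: integral0.
  exact: (measurable_int _ (Lfun2_integrableM (uL A) (vL A))).
apply: filterS uv0 => x uvx _ /=; rewrite /patch; case: ifPn => /= xO.
  by rewrite uvx//; exact: set_mem.
by rewrite mulr0.
Qed.

(** The coefficients converge separately; those of the wrong degree are replaced
    by zero, which makes the limit homogeneous. *)
Lemma L2Lambda_complete k (x : nat -> dform R n) :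
  (forall i, L2Lambda Omega k (x i)) ->
  (forall e, 0 < e -> exists N, forall i j : nat, (N <= i)%N -> (N <= j)%N ->
     nrm (x i - x j) <= e) ->
  exists2 v, L2Lambda Omega k v &
    forall e, 0 < e -> exists N, forall i : nat, (N <= i)%N -> nrm (x i - v) <= e.
Proof.
move=> xk cx; have H := inner_semi.
have xL (i : nat) : L2form (x i) := L2Lambda_L2form (xk i).
have coefB u v A t : coef (u - v) A t = coef u A t - coef v A t.
  by rewrite /patch; case: ifP => _; rewrite ?subr0// !ffunE.
have lim_coef A : exists v : 'rV[R]_n -> R, [/\ v \in Lfun leb 2%:E,
    #|A| != k -> v = cst 0 &
    forall e, 0 < e -> exists N, forall i : nat, (N <= i)%N ->
      \int[leb]_t ((coef (x i) A t - v t) * (coef (x i) A t - v t)) <= e].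
  have [Ak|Ak] := eqVneq #|A| k; last first.
    exists (cst 0); split => //; first exact: (si_mem0 (Lfun2_semi_inner leb)).
    move=> e e0; exists 0%N => i _; rewrite (_ : Rintegral _ _ _ = 0); first exact: (ltW e0).
    rewrite /Rintegral (_ : (\int[leb]_x _)%E = 0%E)//.
    rewrite (@ae_eq_integral _ _ _ leb setT (cst 0%E))//; first exact: integral0.
      apply: (measurable_int leb).
      have := Lfun2_integrableM (xL i A) (xL i A).
      by apply: eq_integrable => // t _ /=; rewrite !subr0.
    apply: filterS ((xk i A).2 Ak) => t xt0 _ /=; rewrite !subr0 /patch.
    by case: ifPn => xO; rewrite ?mulr0// xt0 ?mulr0//; exact: set_mem.
  have [||v vL vP] := @Lfun2_complete _ _ _ leb (fun i => coef (x i) A).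
  - by move=> i; exact: xL.
  - move=> e e0; have [N NP] := cx (Num.sqrt e) ltac:(by rewrite sqrtr_gt0).
    exists N => i j Ni Nj; have := NP _ _ Ni Nj.
    rewrite /l2norm ler_sqrt ?(ltW e0)// => /(le_trans _); apply.
    apply: le_trans (coef_norm_le A (si_memB H (xL i) (xL j))).
    by under [leRHS]eq_Rintegral do rewrite coefB.
  by exists v; split => //; rewrite Ak eqxx.
have /choice[v vP] := lim_coef.
pose V : dform R n := fun t => [ffun A => v A t].
have coefV A : coef V A = patch (cst 0) Omega (v A).
  by apply/funext => t; rewrite /patch; case: ifP => // tO; rewrite ffunE.
have VL : L2form V.
  by move=> A; rewrite coefV; apply: Lfun2_patch => //; have [] := vP A.
exists V.
  move=> A; split => // Ak; have [_ /(_ Ak) vA0 _] := vP A.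
  by apply: nearW => t _; rewrite ffunE vA0.
move=> e e0; pose c : R := #|{set 'I_n}|%:R.
have c0 : 0 < c by rewrite ltr0n; apply/card_gt0P; exists finset.set0.
have /choice[N NP] A : exists N, forall i : nat, (N <= i)%N ->
    \int[leb]_t ((coef (x i) A t - v A t) * (coef (x i) A t - v A t)) <= e ^+ 2 / c.
  by have [_ _] := vP A; apply; rewrite divr_gt0 ?exprn_gt0.
exists (\max_A N A) => i Ni; apply: (nrm_le (ltW e0)).
rewrite inner_coef; [|exact: si_memB H _ _ _ _..].
have -> : e ^+ 2 = \sum_(A : {set 'I_n}) e ^+ 2 / c.
  by rewrite sumr_const -mulr_natr divfK// gt_eqF.
apply: ler_sum => A _; apply: le_trans (NP A i _); last first.
  exact: leq_trans (leq_bigmax A) Ni.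
have [vAL _ _] := vP A.
have L2B f g : f \in Lfun leb 2%:E -> g \in Lfun leb 2%:E -> f - g \in Lfun leb 2%:E.
  by move=> fL gL; apply: (si_memB (Lfun2_semi_inner leb)).
have xiV := si_memB H (xL i) VL.
apply: le_Rintegral => //.
- exact: (Lfun2_integrableM (xiV A) (xiV A)).
- have dL := L2B _ _ (xL i A) vAL.
  exact: (Lfun2_integrableM dL dL).
move=> t _; rewrite coefB coefV /patch; case: ifP => // _.
by rewrite subr0 mul0r -expr2 sqr_ge0.
Qed.

End L2_forms.

(** * The weak exterior derivative *)

Lemma antisym_sum0 (R : numDomainType) (I : finType) (F : I -> I -> R) :
  (forall i j, F i j = - F j i) -> \sum_i \sum_j F i j = 0.
Proof.
move=> anti; set S := (X in X = 0).
have SN : S = - S.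
  rewrite {1}/S exchange_big/= -sumrN; apply: eq_bigr => i _.
  by rewrite -sumrN; apply: eq_bigr => j _; exact: anti.
have : S *+ 2 == 0 by rewrite mulr2n {1}SN addNr.
by rewrite mulrn_eq0/= => /eqP.
Qed.

Section exterior_calculus.
Context {R : realType} {n : nat} (Omega : set 'rV[R]_n).
Implicit Types (u v w z : dform R n) (A B : {set 'I_n}) (i j : 'I_n) (f g : 'rV[R]_n -> R).
Local Notation leb := (@lebesgue_rV R n).
Local Notation nrm := (l2norm Omega).
Local Notation ws := (@wedge_sign R n).
Let H := inner_semi Omega.

(** The form [f dx_B]. *)
Definition monoform f B : dform R n := fun x => [ffun A => f x *+ (A == B)].

(** The opposite of the codifferential of [f dx_B]. *)
Definition monoform_div f B : dform R n :=
  \sum_(i in B) ws i B *: monoform (partial i f) (B :\ i).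

(** The exterior derivative of [f dx_A]. *)
Definition monoform_d f A : dform R n :=
  \sum_(i | i \notin A) ws i (i |: A) *: monoform (partial i f) (i |: A).

Lemma monoform_L2Lambda f B : test_function Omega f -> L2Lambda Omega #|B| (monoform f B).
Proof.
move=> tf A; split.
  have -> : (fun x => monoform f B x A) = (fun x => f x *+ (A == B)).
    by apply/funext => x; rewrite ffunE.
  case: eqP => _; first exact: test_Lfun2.
  rewrite (_ : patch _ _ _ = 0); first exact: (si_mem0 (Lfun2_semi_inner leb)).
  by apply/funext => x; rewrite /patch; case: ifP.
move=> AB; apply: nearW => x _; rewrite ffunE.
by have [AE|//] := eqVneq A B; rewrite AE eqxx in AB.
Qed.

Lemma monoform_L2form f B : test_function Omega f -> L2form Omega (monoform f B).
Proof. by move=> /(monoform_L2Lambda B)/L2Lambda_L2form. Qed.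

Lemma L2Lambda_sum k (P : pred 'I_n) (c : 'I_n -> R) (F : 'I_n -> dform R n) :
  (forall i, P i -> L2Lambda Omega k (F i)) ->
  L2Lambda Omega k (\sum_(i | P i) c i *: F i).
Proof.
move=> kF; elim/big_ind : _ => [|u v uk vk|i Pi].
- exact: L2Lambda0.
- by rewrite -[u]scale1r; exact: L2Lambda_lin.
- by rewrite -[_ *: _]addr0; apply: L2Lambda_lin; [exact: kF|exact: L2Lambda0].
Qed.

Lemma monoform_div_L2Lambda k f B : test_function Omega f -> #|B| = k.+1 ->
  L2Lambda Omega k (monoform_div f B).
Proof.
move=> tf Bk; apply: L2Lambda_sum => i iB.
have -> : k = #|B :\ i| by rewrite (cardsD1 i) iB in Bk; case: Bk.
exact/monoform_L2Lambda/test_partial.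
Qed.

Lemma monoform_d_L2Lambda k f A : test_function Omega f -> #|A| = k ->
  L2Lambda Omega k.+1 (monoform_d f A).
Proof.
move=> tf Ak; apply: L2Lambda_sum => i iA.
have -> : k.+1 = #|i |: A| by rewrite cardsU1 iA Ak.
exact/monoform_L2Lambda/test_partial.
Qed.

Lemma L2form_sum (P : pred 'I_n) (c : 'I_n -> R) (F : 'I_n -> dform R n) :
  (forall i, P i -> L2form Omega (F i)) ->
  L2form Omega (\sum_(i | P i) c i *: F i).
Proof.
move=> LF; elim/big_ind : _ => [|u v|i Pi]; first exact: (si_mem0 H).
  exact: (si_memD H).
exact/(si_memZ H)/LF.
Qed.

Lemma monoform_div_L2form f B : test_function Omega f -> L2form Omega (monoform_div f B).
Proof. by move=> tf; apply: L2form_sum => i _; exact/monoform_L2form/test_partial. Qed.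

Lemma inner_monoform u f B :
  inner Omega u (monoform f B) = \int[leb]_(x in Omega) (u x B * f x).
Proof.
apply: eq_Rintegral => x _; rewrite (bigD1 B)//= big1 ?addr0.
  by rewrite ffunE eqxx.
by move=> A /negPf AB; rewrite ffunE AB mulr0.
Qed.

Lemma inner_monoform2 f g A B :
  inner Omega (monoform f A) (monoform g B) = (\int[leb]_(x in Omega) (f x * g x)) *+ (A == B).
Proof.
rewrite inner_monoform; under eq_Rintegral do rewrite ffunE (eq_sym B).
case: eqP => // _; under eq_Rintegral do rewrite mul0r.
by rewrite /Rintegral integral0.
Qed.

Lemma inner_sum u (P : pred 'I_n) (c : 'I_n -> R) (F : 'I_n -> dform R n) :
  L2form Omega u -> (forall i, P i -> L2form Omega (F i)) ->
  inner Omega u (\sum_(i | P i) c i *: F i) = \sum_(i | P i) c i * inner Omega u (F i).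
Proof.
move=> uL FL.
suff [] : L2form Omega (\sum_(i | P i) c i *: F i) /\
  inner Omega u (\sum_(i | P i) c i *: F i) = \sum_(i | P i) c i * inner Omega u (F i) by [].
elim/big_rec2 : _ => [|i r v Pi [vL vE]].
  by split; [exact: (si_mem0 H)|exact: (ip0r H)].
have cL := si_memZ H (c i) (FL _ Pi).
by split; [exact: (si_memD H)|rewrite (ipDr H)// (ipZr H) ?vE//; exact: FL].
Qed.

(** The weak equation in terms of inner products: both sides are continuous in
    [u] and [w], so the equation passes to limits. *)
Lemma weak_extdP u w : L2form Omega u ->
  weak_extd Omega u w <-> forall B f, test_function Omega f ->
    inner Omega w (monoform f B) = - inner Omega u (monoform_div f B).
Proof.
move=> uL; split=> [uw B f tf|uw B f tf].
  rewrite inner_monoform uw// inner_sum//.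
    by congr (- _); apply: eq_bigr => i _; rewrite inner_monoform.
  by move=> i _; exact/monoform_L2form/test_partial.
rewrite -inner_monoform uw// inner_sum//.
  by congr (- _); apply: eq_bigr => i _; rewrite inner_monoform.
by move=> i _; exact/monoform_L2form/test_partial.
Qed.

Lemma wedge_sign_anti B i j : i \in B -> j \in B -> i != j ->
  ws i B * ws j (B :\ i) =
  - (ws j B * ws i (B :\ j)).
Proof.
wlog ij : i j / (i < j)%N => [hw iB jB nij|].
  have [ij|ji] := ltnP i j; first exact: hw.
  have ji' : (j < i)%N.
    by rewrite ltn_neqAle ji andbT; apply: contra nij => /eqP/val_inj ->.
  by rewrite (hw _ _ ji' jB iB) ?opprK// eq_sym.
move=> iB jB nij.
have -> : ws i (B :\ j) = ws i B.
  rewrite /wedge_sign; congr (_ ^+ #|pred_of_set _|); apply/setP => l; rewrite !inE.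
  by case: eqP => [->|//]; rewrite ltnNge ltnW//= andbF.
suff -> : ws j B = - ws j (B :\ i) by rewrite mulNr opprK mulrC.
rewrite /wedge_sign (cardsD1 i) inE iB ij/= add1n exprS mulN1r; congr (- _ ^+ #|pred_of_set _|).
by apply/setP => l; rewrite !inE andbA.
Qed.

(** [d \o d = 0], weakly: the second derivatives of a test function commute while
    the signs of the two ways to remove two indices are opposite. *)
Lemma weak_extd_extd u w : weak_extd Omega u w -> weak_extd Omega w 0.
Proof.
move=> uw B f tf.
have -> : \int[leb]_(x in Omega) ((0 : dform R n) x B * f x) = 0.
  by under eq_Rintegral do rewrite ffunE mul0r; rewrite /Rintegral integral0.
apply/esym/eqP; rewrite oppr_eq0; apply/eqP.
pose F i j := if [&& i \in B, j \in B & i != j] then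
  ws i B * ws j (B :\ i) *
  \int[leb]_(x in Omega) (u x (B :\ i :\ j) * partial j (partial i f) x) else 0.
transitivity (- \sum_i \sum_j F i j); last first.
  rewrite antisym_sum0 ?oppr0// => i j; rewrite /F.
  case: (boolP (i \in B)) => iB; case: (boolP (j \in B)) => jB; rewrite ?oppr0//=.
  rewrite (eq_sym j); case: eqP => [_|/eqP nij] /=; rewrite ?oppr0//.
  rewrite (wedge_sign_anti iB jB nij) mulNr.
  apply: (congr1 (fun r => - (_ * r))); rewrite finset.setDDl finset.setUC -finset.setDDl.
  by apply: eq_Rintegral => x _; rewrite (test_partialC i j tf).
rewrite -sumrN big_mkcond; apply: eq_bigr => i _.
case: (boolP (i \in B)) => iB; last first.
  by rewrite big1 ?oppr0// => j _; rewrite /F (negPf iB).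
rewrite (uw _ _ (test_partial i tf)) mulrN mulr_sumr; congr (- _).
rewrite big_mkcond; apply: eq_bigr => j _; rewrite /F !inE iB/=.
by rewrite (eq_sym j) andbC; case: ifP => // _; rewrite mulrA.
Qed.

Lemma weak_extd_lin a u v w z : L2form Omega u -> L2form Omega v ->
  L2form Omega w -> L2form Omega z ->
  weak_extd Omega u w -> weak_extd Omega v z ->
  weak_extd Omega (a *: u + v) (a *: w + z).
Proof.
move=> uL vL wL zL /(weak_extdP _ uL) uw /(weak_extdP _ vL) vz.
apply/weak_extdP => [|B f tf]; first exact: (si_memP H).
have tL := monoform_L2form B tf; have cL := monoform_div_L2form B tf.
by rewrite !(si_linl H)// uw// vz// mulrN opprD.
Qed.

(** Integration by parts in each direction [i]: the conditions [i \notin A] and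
    [B = i |: A] on the one side amount to [i \in B] and [A = B :\ i] on the other. *)
Lemma monoform_weak_extd f A : test_function Omega f ->
  weak_extd Omega (monoform f A) (monoform_d f A).
Proof.
move=> tf; apply/weak_extdP => [|B g tg]; first exact: monoform_L2form.
have tL := monoform_L2form B tg.
rewrite (si_sym H) inner_sum//; last by move=> i _; exact/monoform_L2form/test_partial.
rewrite [in RHS]inner_sum//; last 2 first.
- exact: monoform_L2form.
- by move=> i _; exact/monoform_L2form/test_partial.
rewrite -sumrN [LHS]big_mkcond [RHS]big_mkcond; apply: eq_bigr => i _.
have E : (i \notin A) && (B == i |: A) = (i \in B) && (A == B :\ i).
  apply/andP/andP => -[].
    by move=> iA /eqP ->; rewrite finset.setU11 finset.setU1K ?eqxx.
  by move=> iB /eqP ->; rewrite finset.setD11 finset.setD1K ?eqxx.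
rewrite !inner_monoform2; move: E.
case: (i \notin A); case: (boolP (i \in B)) => iB //= E.
- rewrite E; move: E; case: eqP => [AB _|_ <-]; last by rewrite !mulr0n !mulr0 oppr0.
  rewrite -AB -mulrN; case: eqP => _; last by rewrite mulr0n oppr0 !mulr0.
  rewrite -[LHS]/(_ * (\int[leb]_(x in Omega) (g x * partial i f x))).
  rewrite -[X in - X]/(\int[leb]_(x in Omega) (f x * partial i g x)).
  rewrite -(test_ibp i tf tg); congr (_ * _).
  by apply: eq_Rintegral => x _; exact: mulrC.
- by rewrite E mulr0.
- by rewrite -E mulr0 oppr0.
Qed.

End exterior_calculus.

(** * The Hodge star and the weak codifferential *)

Section star.
Context {R : realType} {n : nat} (Omega : set 'rV[R]_n).
Implicit Types (u v w z : dform R n) (A B : {set 'I_n}) (i j : 'I_n) (f g : 'rV[R]_n -> R).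
Local Notation leb := (@lebesgue_rV R n).
Local Notation nrm := (l2norm Omega).
Local Notation ws := (@wedge_sign R n).
Local Notation ss := (@star_sign R n).
Let H := inner_semi Omega.

(** Adding [i] to [A] removes the inversions [(a, i)] with [i < a], counted by [hi], and
    adds the inversions [(i, b)] with [b < i], counted by [wedge_sign i (~: A)]; the
    inversions in [T] are common to [A] and [i |: A]. *)
Lemma star_signU1 i A : i \notin A ->
  ss (i |: A) = (-1) ^+ #|A| * ws i (i |: A) * ws i (~: A) * ss A.
Proof.
move=> iA; pose T := [set p : 'I_n * 'I_n |
  [&& p.1 \in A, p.2 \notin A, p.2 != i & (p.2 < p.1)%N]]%SET.
pose lo := [set j in A | (j < i)%N]%SET; pose hi := [set j in A | (i < j)%N]%SET.
have wsU : ws i (i |: A) = (-1) ^+ #|lo|.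
  rewrite /wedge_sign; congr (_ ^+ _); apply: eq_card => j; rewrite !inE.
  by case: eqP => [->|//]; rewrite ltnn !andbF.
have cardA : #|A| = (#|lo| + #|hi|)%N.
  rewrite -(cardsID [set j : 'I_n | (j < i)%N]%SET A).
  congr (_ + _)%N; apply: eq_card => j; rewrite !inE//.
  rewrite -leqNgt andbC; case: (boolP (j \in A)) => //= jA.
  rewrite leq_eqVlt; case: eqP => //= /val_inj ij; by rewrite ij jA in iA.
have ssU : ss (i |: A) = (-1) ^+ #|T| * ws i (~: A).
  rewrite /star_sign /wedge_sign -exprD; congr (_ ^+ _).
  rewrite -(cardsID [set p : 'I_n * 'I_n | p.1 == i]%SET) addnC; congr addn.
    apply: eq_card => -[a b]; rewrite !inE /= negb_or.
    have [->|ai] := eqVneq a i; first by rewrite (negPf iA).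
    by case: (a \in A); case: (b \in A); case: (b == i); case: (b < a)%N.
  rewrite -(card_imset _ (_ : injective (fun b : 'I_n => (i, b)))); last by move=> b b' [].
  apply: eq_card => -[a b]; rewrite !inE /=.
  apply/andP/imsetP => [[/and3P[_ + lt] /eqP ai]|[c + [-> ->]]].
    rewrite negb_or => /andP[_ bA]; exists b; last by rewrite ai.
    by rewrite !inE bA -ai.
  rewrite !inE => /andP[cA ci]; rewrite eqxx ci negb_or cA !andbT/=; split=> //.
  by apply/eqP => cE; rewrite cE ltnn in ci.
have ssA : ss A = (-1) ^+ #|T| * (-1) ^+ #|hi|.
  rewrite /star_sign -exprD; congr (_ ^+ _).
  rewrite -(cardsID [set p : 'I_n * 'I_n | p.2 == i]%SET) addnC; congr addn.
    apply: eq_card => -[a b]; rewrite !inE /=.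
    by case: (a \in A); case: (b \in A); case: (b == i); case: (b < a)%N.
  rewrite -(card_imset _ (_ : injective (fun a : 'I_n => (a, i)))); last by move=> b b' [].
  apply: eq_card => -[a b]; rewrite !inE /=.
  apply/andP/imsetP => [[/and3P[aA bA lt] /eqP bi]|[c + [-> ->]]].
    by exists a; rewrite ?inE ?aA -?bi.
  by rewrite !inE => /andP[cA ci]; rewrite eqxx ci cA iA.
rewrite ssU ssA wsU cardA exprD.
have sq k : (-1) ^+ k * (-1) ^+ k = 1 :> R by rewrite -exprD addnn -mul2n exprM sqrrN !expr1n.
have := sq #|lo|; have := sq #|hi|.
move: ((-1) ^+ #|lo|) ((-1) ^+ #|hi|) ((-1) ^+ #|T|) (ws i (~: A)) => a b t w bb aa.
have -> : a * b * a * w * (t * b) = (a * a) * (b * b) * (t * w) by ring.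
by rewrite aa bb !mul1r.
Qed.

Lemma inner_ae_eq0 k l u v : L2Lambda Omega k u -> L2Lambda Omega l v -> k != l ->
  inner Omega u v = 0.
Proof.
move=> uk vl kl; apply: inner_ae0l; last 2 first.
- exact: L2Lambda_L2form uk.
- exact: L2Lambda_L2form vl.
have uv0 A : {ae leb, forall x, Omega x -> u x A * v x A = 0}.
  have [Ak|Ak] := eqVneq #|A| k.
    apply: filterS ((vl A).2 _) => [x v0 Ox|]; last by rewrite Ak.
    by rewrite v0// mulr0.
  by apply: filterS ((uk A).2 Ak) => x u0 Ox; rewrite u0// mul0r.
have FF : Filter (almost_everywhere leb) by exact: ae_filter_ringOfSetsType.
have uvA := filter_forall FF uv0.
by apply: filterS uvA => x uvx Ox A; exact: uvx.
Qed.

(** One instance of the weak equation that defines the codifferential.  The signs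
    cancel when [#|A|.+1 = k], and otherwise both inner products are zero, for
    reasons of degree. *)
Lemma weak_extd_starP k u w f A : L2Lambda Omega k u -> L2Lambda Omega k.-1 w ->
  test_function Omega f ->
  (\int[leb]_(x in Omega) (((-1) ^+ k *: star w) x (~: A) * f x) =
    - \sum_(i in ~: A) ws i (~: A) *
        \int[leb]_(x in Omega) (star u x (~: A :\ i) * partial i f x)) <->
  inner Omega w (monoform f A) = inner Omega u (monoform_d f A).
Proof.
move=> uk wk tf.
have uL := L2Lambda_L2form uk; have wL := L2Lambda_L2form wk.
have tL := monoform_L2form A tf.
have ss0 B : ss B != 0 by rewrite /star_sign signr_eq0.
have RintZ c u' B g : L2form Omega u' -> test_function Omega g ->
    \int[leb]_(x in Omega) (c * u' x B * g x) = c * inner Omega u' (monoform g B).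
  move=> u'L tg; rewrite -(ipZl H)//; last exact: monoform_L2form.
  rewrite inner_monoform; apply: eq_Rintegral => x _.
  by rewrite -[c *: u']addr0 dform_linE !ffunE addr0.
have -> : \int[leb]_(x in Omega) (((-1) ^+ k *: star w) x (~: A) * f x) =
    (-1) ^+ k * ss A * inner Omega w (monoform f A).
  rewrite -RintZ//; apply: eq_Rintegral => x _.
  by rewrite -[_ *: star w]addr0 dform_linE !ffunE addr0 finset.setCK mulrA.
have -> : - (\sum_(i in ~: A) ws i (~: A) *
        \int[leb]_(x in Omega) (star u x (~: A :\ i) * partial i f x)) =
    (-1) ^+ #|A|.+1 * ss A * inner Omega u (monoform_d f A).
  rewrite inner_sum//; last by move=> i _; exact/monoform_L2form/test_partial.
  rewrite mulr_sumr -sumrN; apply: eq_big => [i|i iA]; first by rewrite inE.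
  rewrite inE in iA.
  have E : ~: (~: A :\ i) = i |: A by rewrite finset.setCD finset.setCK finset.setUC.
  under eq_Rintegral do rewrite ffunE E.
  rewrite RintZ//; last exact: test_partial.
  rewrite (star_signU1 iA) exprS.
  have : ws i (~: A) * ws i (~: A) = 1 by rewrite /wedge_sign -exprD addnn -mul2n exprM sqrrN !expr1n.
  move: (inner _ _ _) (ws i (~: A)) (ws i (i |: A)) (ss A) (_ ^+ #|A|) => I c d a b cc.
  have -> : - (c * (b * d * c * a * I)) = - (c * c) * (b * d * a * I) by ring.
  by rewrite cc; ring.
have [kA|kA] := eqVneq k #|A|.+1.
  rewrite kA; split=> [|-> //].
  by apply: mulfI; rewrite mulf_neq0// signr_eq0.
have -> : inner Omega u (monoform_d f A) = 0.
  by apply: inner_ae_eq0 uk _ kA; exact: monoform_d_L2Lambda.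
rewrite mulr0; split=> [/eqP|->]; last by rewrite mulr0.
by rewrite !mulf_eq0 signr_eq0 (negPf (ss0 A))/= => /eqP.
Qed.

(** The codifferential is the adjoint of the exterior derivative on the forms
    [f dx_A].  For [k = 0] the right-hand sides vanish, so that [w = 0] is the only
    codifferential although [k.-1 = 0]. *)
Lemma is_deltaP k u w : L2Lambda Omega k u ->
  is_delta Omega k u w <-> L2Lambda Omega k.-1 w /\
    forall A f, test_function Omega f ->
      inner Omega w (monoform f A) = inner Omega u (monoform_d f A).
Proof.
move=> uk; split=> -[wk uw]; split => // A f tf.
  by apply/(weak_extd_starP A uk wk tf); exact: uw.
have := (weak_extd_starP (~: A) uk wk tf).2 (uw (~: A) f tf).
by rewrite finset.setCK.
Qed.

Lemma is_delta_intro k u w : L2Lambda Omega k.+1 u -> L2Lambda Omega k w ->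
  (forall A f, #|A| = k -> test_function Omega f ->
    inner Omega w (monoform f A) = inner Omega u (monoform_d f A)) ->
  is_delta Omega k.+1 u w.
Proof.
move=> uk wk uw; apply/is_deltaP => //; split => // A f tf.
have [Ak|Ak] := eqVneq #|A| k; first exact: uw.
rewrite (inner_ae_eq0 wk (monoform_L2Lambda A tf)) 1?eq_sym//.
by rewrite (inner_ae_eq0 uk (monoform_d_L2Lambda tf erefl)) ?eqSS 1?eq_sym.
Qed.

Lemma is_delta0 u : L2Lambda Omega 0 u -> is_delta Omega 0 u 0.
Proof.
move=> u0; apply/is_deltaP => //; split=> [|A f tf]; first exact: L2Lambda0.
rewrite (ip0l H); last exact: monoform_L2form.
by rewrite (inner_ae_eq0 u0 (monoform_d_L2Lambda tf erefl)).
Qed.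

(** [delta \o delta = 0], which is [d \o d = 0] for the dual forms. *)
Lemma is_delta_delta k v dv : is_delta Omega k.+1 v dv -> is_delta Omega k dv 0.
Proof.
move=> [dvk /weak_extd_extd dd]; split; first exact: L2Lambda0.
have sL : L2form Omega (star dv).
  move=> B; have -> : patch (cst 0) Omega (fun x => star dv x B) =
      ss (~: B) *: patch (cst 0) Omega (fun x => dv x (~: B)) + 0.
    apply/funext => x; rewrite addr0.
    change (patch (cst 0) Omega (fun x => star dv x B) x =
      ss (~: B) * patch (cst 0) Omega (fun x => dv x (~: B)) x).
    by rewrite /patch; case: ifP => _; rewrite ?mulr0// ffunE.
  apply: Lfun2_linear; first exact: (dvk _).1.
  exact: (si_mem0 (Lfun2_semi_inner leb)).
have cL := si_memZ H ((-1) ^+ k.+1) sL.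
move/(weak_extdP _ cL) in dd.
apply/(weak_extdP _ sL) => B f tf.
have tL := monoform_L2form B tf; have tcL := monoform_div_L2form B tf.
have := dd B f tf; rewrite (ip0l H)// (ipZl H)// => /esym/eqP.
rewrite oppr_eq0 mulf_eq0 signr_eq0/= => /eqP ->.
rewrite oppr0 (_ : _ *: star 0 = 0) ?(ip0l H)//.
apply/funext => x; apply/ffunP => A.
by rewrite -[_ *: star 0]addr0 dform_linE !ffunE !mulr0 addr0.
Qed.

End star.

(** * Forms with vanishing trace *)

Section hilbert_complex.
Context {R : realType} {n : nat} (Omega : set 'rV[R]_n).
Implicit Types (u v w z : dform R n) (A B : {set 'I_n}) (f g : 'rV[R]_n -> R).
Implicit Types (j k : nat) (i : 'I_n).
Local Notation leb := (@lebesgue_rV R n).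
Local Notation nrm := (l2norm Omega).
Local Notation ip := (inner Omega).
Hypothesis oO : open Omega.
Hypothesis bO : bounded_set Omega.
Hypothesis H0 : forall j, (j <= n)%N -> Hring Omega j 0.
Let mO : measurable Omega := open_rV_measurable oO.
Let H := inner_semi Omega.

Lemma weak_extd00 : weak_extd Omega 0 0.
Proof.
apply/(weak_extdP _ (si_mem0 H)) => B f tf.
have tL := monoform_L2form B tf; have cL := monoform_div_L2form B tf.
by rewrite (ip0l H tL) (ip0l H cL) oppr0.
Qed.

Lemma is_d_lin k a u v w z : L2Lambda Omega k u -> L2Lambda Omega k v ->
  is_d Omega k u w -> is_d Omega k v z -> is_d Omega k (a *: u + v) (a *: w + z).
Proof.
move=> uk vk [wk uw] [zk vz]; split; first exact: L2Lambda_lin.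
by apply: weak_extd_lin => //; apply: L2Lambda_L2form; eassumption.
Qed.

Lemma is_d00 k : is_d Omega k 0 0.
Proof. by split; [exact: L2Lambda0|exact: weak_extd00]. Qed.

Lemma is_d_d k u w : is_d Omega k u w -> is_d Omega k.+1 w 0.
Proof. by move=> [_ /weak_extd_extd dd]; split; [exact: L2Lambda0|]. Qed.

Lemma is_d_top k u : k = n -> L2Lambda Omega k u -> is_d Omega k u 0.
Proof.
move=> -> un; split; first exact: L2Lambda0.
apply/weak_extdP => [|B f tf]; first exact: L2Lambda_L2form un.
rewrite (ip0l H); last exact: monoform_L2form.
have [/eqP|] := boolP (#|B| == 0%N).
  move/finset.cards0_eq => ->; rewrite /monoform_div big_pred0 => [|i]; last by rewrite inE.
  by rewrite (ip0r H) ?oppr0//; exact: L2Lambda_L2form un.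
rewrite -lt0n => B0; rewrite (inner_ae_eq0 un (monoform_div_L2Lambda tf (esym (prednK B0)))) ?oppr0//.
rewrite gtn_eqF// prednK//.
by have := max_card (mem B); rewrite card_ord.
Qed.

Lemma Hring_L2Lambda k u : Hring Omega k u -> L2Lambda Omega k u.
Proof. by rewrite /Hring; case: eqP => [->|_] [] // []. Qed.

Lemma trace0 k : (k < n)%N -> trace_zero Omega k 0.
Proof. by move=> kn; have := H0 (ltnW kn); rewrite /Hring ltn_eqF// => -[]. Qed.

Lemma Hring_trace k u : (k < n)%N -> Hring Omega k u -> trace_zero Omega k u.
Proof. by move=> kn; rewrite /Hring ltn_eqF// => -[]. Qed.

Lemma Hring_has_d k u : (k < n)%N -> Hring Omega k u -> exists w, is_d Omega k u w.
Proof. by move=> kn; rewrite /Hring ltn_eqF// => -[[]]. Qed.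

(** The weak exterior derivative is unique, at least when tested against the forms
    that occur in Green's formula: this is what a vanishing trace of the zero form
    says. *)
Lemma inner_d_unique k u w w' v dv : (k < n)%N -> L2Lambda Omega k u ->
  is_d Omega k u w -> is_d Omega k u w' ->
  L2Lambda Omega k.+1 v -> is_delta Omega k.+1 v dv -> ip w v = ip w' v.
Proof.
move=> kn uk uw uw' vk vdv; have := is_d_lin (-1) uk uk uw' uw.
rewrite scaleN1r addNr => d0; have := trace0 kn d0 vk vdv.
rewrite (ip0l H) ?subr0; last exact: L2Lambda_L2form vdv.1.
rewrite (si_linl H); [|exact: L2Lambda_L2form uw'.1|exact: L2Lambda_L2form uw.1
                      |exact: L2Lambda_L2form vk].
by rewrite mulN1r => /eqP; rewrite addrC subr_eq0 => /eqP.
Qed.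

(** By uniqueness, it is enough to check Green's formula for one weak exterior
    derivative [w]. *)
Lemma Hring_intro k u w : (k < n)%N -> L2Lambda Omega k u -> is_d Omega k u w ->
  (forall v dv, L2Lambda Omega k.+1 v -> is_delta Omega k.+1 v dv ->
    ip w v = ip u dv) -> Hring Omega k u.
Proof.
move=> kn uk uw green; rewrite /Hring ltn_eqF//; split.
  by split => //; exists w.
move=> w' v dv uw' vk vdv; rewrite (inner_d_unique kn uk uw' uw vk vdv).
by rewrite (green _ _ vk vdv) subrr.
Qed.

Lemma Hring_green k u w v dv : (k < n)%N -> Hring Omega k u -> is_d Omega k u w ->
  L2Lambda Omega k.+1 v -> is_delta Omega k.+1 v dv -> ip w v = ip u dv.
Proof.
by move=> kn ku uw vk vdv; apply/eqP; rewrite -subr_eq0 (Hring_trace kn ku uw vk vdv).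
Qed.

(** In top degree the condition of zero mean is orthogonality to [volume_form], whose
    codifferential is zero; it thus behaves like a vanishing trace. *)
Definition volume_form : dform R n := fun x => [ffun A => (A == finset.setT)%:R].

Lemma lebesgue_domain_lty : (leb Omega < +oo)%E.
Proof.
have [M OM] : exists M, Omega `<=` @cube R n M.
  have [M [Mreal KM]] := bO; exists (M + 1) => x Ox i.
  rewrite in_itv/= -ler_norml (le_trans (ler_coord_norm x i))//.
  by apply: KM => //; rewrite ltrDl.
apply: le_lt_trans (lebesgue_cube_lty n M).
by apply: le_measure => //; rewrite inE//; exact: measurable_cube.
Qed.

Lemma volume_form_L2Lambda : L2Lambda Omega n volume_form.
Proof.
move=> A; split.
  have -> : (fun x => volume_form x A) = cst (A == finset.setT)%:R.
    by apply/funext => x; rewrite ffunE.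
  apply: Lfun2I.
    by apply: (measurable_restrictT (cst _) mO).1; exact: measurable_cst.
  have : leb.-integrable Omega (EFin \o cst ((A == finset.setT)%:R ^+ 2 : R)).
    apply: measurable_bounded_integrable => //; first exact: lebesgue_domain_lty.
    exists `|(A == finset.setT)%:R ^+ 2 : R|; split; first exact: num_real.
    by move=> M /ltW cM x _.
  move/(integrable_mkcond _ mO); apply: eq_integrable => // x _.
  rewrite /patch /=; case: ifP => xO //=.
  by rewrite expr0n.
move=> An; apply: nearW => x _; rewrite ffunE.
have [AT|//] := eqVneq A finset.setT.
by rewrite AT cardsT card_ord eqxx in An.
Qed.

Lemma inner_volume u : ip u volume_form = \int[leb]_(x in Omega) u x finset.setT.
Proof.
apply: eq_Rintegral => x _; rewrite (bigD1 finset.setT)//= big1 ?addr0.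
  by rewrite ffunE eqxx mulr1.
by move=> A /negPf AB; rewrite ffunE AB mulr0.
Qed.

Lemma volume_delta0 : is_delta Omega n volume_form 0.
Proof.
have vL := volume_form_L2Lambda.
apply/is_deltaP => //; split=> [|A f tf]; first exact: L2Lambda0.
rewrite (ip0l H); last exact: monoform_L2form.
rewrite inner_sum//; last 2 first.
- exact: L2Lambda_L2form vL.
- by move=> i _; exact/monoform_L2form/test_partial.
rewrite big1// => i _; rewrite inner_monoform.
under eq_Rintegral do rewrite ffunE.
case: eqP => _; last first.
  by under eq_Rintegral do rewrite mul0r; rewrite /Rintegral integral0 mulr0.
by under eq_Rintegral do rewrite mul1r; rewrite (Rintegral_test_partial i tf) mulr0.
Qed.

Lemma Hring_topP u : Hring Omega n u <-> L2Lambda Omega n u /\ ip u volume_form = 0.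
Proof. by rewrite /Hring eqxx inner_volume. Qed.

Lemma Hring_lin k a u v : (k <= n)%N -> Hring Omega k u -> Hring Omega k v ->
  Hring Omega k (a *: u + v).
Proof.
rewrite leq_eqVlt => /predU1P[->|kn].
  move=> /Hring_topP[uL u0] /Hring_topP[vL v0]; apply/Hring_topP; split.
    exact: L2Lambda_lin.
  rewrite (si_linl H) ?u0 ?v0 ?mulr0 ?addr0//; apply: L2Lambda_L2form; eauto.
  exact: volume_form_L2Lambda.
move=> uH vH; have uk := Hring_L2Lambda uH; have vk := Hring_L2Lambda vH.
have [w uw] := Hring_has_d kn uH; have [z vz] := Hring_has_d kn vH.
apply: (Hring_intro kn (w := a *: w + z)); [exact: L2Lambda_lin|exact: is_d_lin|].
move=> y dy yk ydy; have yL := L2Lambda_L2form yk; have dyL := L2Lambda_L2form ydy.1.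
rewrite !(si_linl H)//; last 4 first.
- exact: L2Lambda_L2form uk.
- exact: L2Lambda_L2form vk.
- exact: L2Lambda_L2form uw.1.
- exact: L2Lambda_L2form vz.1.
by rewrite (Hring_green kn uH uw yk ydy) (Hring_green kn vH vz yk ydy).
Qed.

Lemma monoform_is_d f A : test_function Omega f ->
  is_d Omega #|A| (monoform f A) (monoform_d f A).
Proof. by move=> tf; split; [exact: monoform_d_L2Lambda|exact: monoform_weak_extd]. Qed.

Lemma monoform_Hring f A : (#|A| < n)%N -> test_function Omega f ->
  Hring Omega #|A| (monoform f A).
Proof.
move=> An tf; apply: (Hring_intro An (monoform_L2Lambda A tf) (monoform_is_d A tf)).
move=> v dv vA vdv; rewrite (si_sym H) (si_sym H (monoform f A)).
by have /(is_deltaP _ vA)[_ ->] := vdv.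
Qed.

End hilbert_complex.

(** * Closure of the exact forms and prescribed codifferentials *)

Section hodge.
Context {R : realType} {n : nat} (Omega : set 'rV[R]_n).
Implicit Types (u v w z q p b x g du dq : dform R n) (A B : {set 'I_n}) (f : 'rV[R]_n -> R).
Implicit Types (j k : nat) (i : 'I_n).
Local Notation nrm := (l2norm Omega).
Local Notation ip := (inner Omega).
Hypothesis oO : open Omega.
Hypothesis bO : bounded_set Omega.
Hypothesis H0 : forall j, (j <= n)%N -> Hring Omega j 0.
Let mO : measurable Omega := open_rV_measurable oO.
Let H := inner_semi Omega.

(** Degree zero has no exact forms but [0]; with this convention the degrees
    [0] and [k.+1] are treated together. *)
Definition exact_form k x :=
  if k is j.+1 then exists2 q, Hring Omega j q & is_d Omega j q x else x = 0.

Local Notation cl k := (sclosure (L2form Omega) ip (exact_form k)).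

Lemma exact_L2Lambda k x : exact_form k x -> L2Lambda Omega k x.
Proof. by case: k => [->|k [q _ []//]]; exact: L2Lambda0. Qed.

Lemma exact_L2form k : exact_form k `<=` L2form Omega.
Proof. by move=> x /exact_L2Lambda/L2Lambda_L2form. Qed.

Lemma exact0 k : (k <= n)%N -> exact_form k 0.
Proof. by case: k => // k kn; exists 0; [exact/H0/ltnW|exact: is_d00]. Qed.

Lemma exact_lin k a x y : (k <= n)%N -> exact_form k x -> exact_form k y ->
  exact_form k (a *: x + y).
Proof.
case: k => [_ -> ->|k kn [q qH qx] [p pH py]]; first by rewrite scaler0 addr0.
exists (a *: q + p); first exact: (Hring_lin oO bO H0 a (ltnW kn)).
by apply: is_d_lin => //; apply: Hring_L2Lambda; eassumption.
Qed.

Lemma sclosure_exact_orth k b w : L2form Omega w -> cl k b ->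
  (forall x, exact_form k x -> ip x w = 0) -> ip b w = 0.
Proof.
move=> wL bcl xw; rewrite -(ip0r H bcl.1).
apply: (sclosure_ip H (@exact_L2form k) wL (si_mem0 H) bcl) => x kx.
by rewrite xw// (ip0r H)//; exact: exact_L2form kx.
Qed.

Lemma sclosure_exact_d k b : L2Lambda Omega k b -> cl k b -> is_d Omega k b 0.
Proof.
move=> bk bcl; split; first exact: L2Lambda0.
apply/(weak_extdP _ bcl.1) => B f tf.
have tL := monoform_L2form B tf; have cL := monoform_div_L2form B tf.
rewrite (ip0l H tL) (sclosure_exact_orth cL bcl) ?oppr0// => x.
case: k {bk bcl} => [->|k [q _ qx]]; first exact: (ip0l H cL).
have xL := L2Lambda_L2form qx.1.
have [_ /(weak_extdP _ xL)/(_ B f tf)] := is_d_d qx.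
by rewrite (ip0l H tL) => /esym/eqP; rewrite oppr_eq0 => /eqP.
Qed.

(** For [x = d q] the pairing with [dv] is the pairing of [q] with [delta dv = 0]. *)
Lemma sclosure_exact_green k b v dv : (k < n)%N -> cl k b ->
  L2Lambda Omega k.+1 v -> is_delta Omega k.+1 v dv -> ip b dv = 0.
Proof.
move=> kn bcl vk vdv; have dvL := L2Lambda_L2form vdv.1.
apply: (sclosure_exact_orth dvL bcl) => x.
case: k kn vk vdv {bcl} => [|k] kn vk vdv; first by move=> ->; exact: (ip0l H dvL).
move=> [q qH qx]; rewrite (Hring_green (ltnW kn) qH qx vdv.1 (is_delta_delta vdv)).
by rewrite (ip0r H)//; exact/L2Lambda_L2form/Hring_L2Lambda/qH.
Qed.

Lemma sclosure_exact_volume k b : k = n -> cl k b -> ip b volume_form = 0.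
Proof.
move=> kn bcl; have vk := volume_form_L2Lambda oO bO; have vL := L2Lambda_L2form vk.
apply: (sclosure_exact_orth vL bcl) => x {bcl}.
have vd := volume_delta0 oO bO; rewrite -[X in is_delta _ X]kn in vd.
rewrite -[X in L2Lambda _ X]kn in vk.
case: k kn vk vd => [|k] kn vk vd; first by move=> ->; exact: (ip0l H vL).
have kn' : (k < n)%N by rewrite kn.
move=> [q qH qx]; rewrite (Hring_green kn' qH qx vk vd).
by rewrite (ip0r H)//; exact/L2Lambda_L2form/Hring_L2Lambda/qH.
Qed.

Lemma sclosure_exact_Hring k b : (k <= n)%N -> L2Lambda Omega k b -> cl k b ->
  Hring Omega k b.
Proof.
rewrite leq_eqVlt => /predU1P[->|kn] bk bcl.
  by apply/Hring_topP; split => //; exact: (sclosure_exact_volume erefl).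
apply: (Hring_intro H0 kn bk (sclosure_exact_d bk bcl)) => v dv vk vdv.
by rewrite (sclosure_exact_green kn bcl vk vdv) (ip0l H)//; exact: L2Lambda_L2form vk.
Qed.

(** Riesz representation, on the exact forms, of [d q |-> (u, d q) - (g, q)]: the
    bound on [g] makes this well defined and continuous.  Testing with the forms
    [f dx_A] then shows that [g] is the codifferential of [u - b]. *)
Lemma hodge_split j u du g (K : R) : (j < n)%N -> Hring Omega j.+1 u ->
  is_d Omega j.+1 u du -> L2Lambda Omega j g ->
  (forall q dq, Hring Omega j q -> is_d Omega j q dq -> `|ip g q| <= K * nrm dq) ->
  exists b, [/\ L2Lambda Omega j.+1 b, cl j.+1 b, Zspace Omega j.+1 (u - b) &
    [/\ is_d Omega j.+1 (u - b) du, is_delta Omega j.+1 (u - b) g &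
    forall q dq, Hring Omega j q -> is_d Omega j q dq -> ip (u - b) dq = ip g q]].
Proof.
move=> jn uH udu gj gK; have uk := Hring_L2Lambda uH.
have uL := L2Lambda_L2form uk; have gL := L2Lambda_L2form gj.
pose X x (t : R) := exists q, [/\ Hring Omega j q, is_d Omega j q x & t = ip u x - ip g q].
have [||||b [bk bcl bX]] := @riesz _ _ _ _ H (L2Lambda Omega j.+1)
    (@L2Lambda_L2form _ _ _ _) (@L2Lambda_complete _ _ _ mO j.+1) X (nrm u + K).
- exists 0; split; [exact/H0/ltnW|exact: is_d00|].
  by rewrite (ip0r H uL) (ip0r H gL) subr0.
- move=> a x y _ _ [q [qH qx ->]] [p [pH py ->]]; exists (a *: q + p); split.
  + exact: (Hring_lin oO bO H0 a (ltnW jn)).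
  + by apply: is_d_lin => //; apply: Hring_L2Lambda; eassumption.
  have xL := L2Lambda_L2form qx.1; have yL := L2Lambda_L2form py.1.
  have qL := L2Lambda_L2form (Hring_L2Lambda qH).
  have pL := L2Lambda_L2form (Hring_L2Lambda pH).
  rewrite !(si_sym H u) !(si_sym H g) !(si_linl H)//; ring.
- by move=> x t [q [_ []]].
- move=> x _ [q [qH qx ->]]; rewrite (le_trans (ler_normB _ _))// mulrDl.
  have xL := L2Lambda_L2form qx.1.
  by rewrite lerD ?gK// (cauchy_schwarz H).
have bL := L2Lambda_L2form bk.
have bcl' : cl j.+1 b.
  split => // e e0; have [_ /(_ _ e0)[x [t [q [qH qx _]]] xb]] := bcl.
  by exists x => //; exists q.
have bd : is_d Omega j.+1 b 0 by exact: sclosure_exact_d.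
have subE z w : (-1) *: w + z = z - w by rewrite scaleN1r addrC.
have zk : L2Lambda Omega j.+1 (u - b) by rewrite -subE; exact: L2Lambda_lin.
have zd q dq : Hring Omega j q -> is_d Omega j q dq -> ip (u - b) dq = ip g q.
  move=> qH qdq; have dqL := L2Lambda_L2form qdq.1.
  by rewrite (ipBl H)// (bX dq (ip u dq - ip g q)) ?subKr//; exists q.
have zdelta : is_delta Omega j.+1 (u - b) g.
  apply: is_delta_intro => // A f Aj tf; symmetry; apply: zd.
    by rewrite -Aj; apply: monoform_Hring => //; rewrite Aj.
  by rewrite -Aj; exact: monoform_is_d.
exists b; split => //.
  split; last by split => //; exists g.
  by rewrite -subE; apply: (Hring_lin oO bO H0) => //; exact: sclosure_exact_Hring.
split => //; rewrite -subE -[du]add0r -[0 in X in is_d _ _ _ X](scaler0 _ (-1)).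
exact: is_d_lin.
Qed.

Lemma Zspace0 u : Hring Omega 0 u -> Zspace Omega 0 u.
Proof.
move=> uH; have u0 := Hring_L2Lambda uH; split => //.
by split => //; exists 0; exact: is_delta0.
Qed.

(** The part of [q] orthogonal to the exact forms: the case of a zero codifferential. *)
Lemma coexact_part j q dq : (j <= n)%N -> Hring Omega j q -> is_d Omega j q dq ->
  exists p, [/\ L2Lambda Omega j p, cl j p, Zspace Omega j (q - p) &
    [/\ is_d Omega j (q - p) dq, is_delta Omega j (q - p) 0 &
    forall x, exact_form j x -> ip (q - p) x = 0]].
Proof.
case: j => [|j] jn qH qdq.
  have q0 := Hring_L2Lambda qH.
  exists 0; rewrite subr0; split; [exact: L2Lambda0| |exact: Zspace0|].
    split=> [|e e0]; first exact: (si_mem0 H).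
    by exists 0 => //; rewrite subrr (ip0l H (si_mem0 H)) sqrtr0 ltW.
  split => //; first exact: is_delta0.
  by move=> _ ->; rewrite (ip0r H)//; exact: L2Lambda_L2form q0.
have ip0 y : Hring Omega j y -> ip 0 y = 0.
  by move=> /Hring_L2Lambda/L2Lambda_L2form/(ip0l H).
have [|p [pk pcl pZ [pd pdelta porth]]] :=
    @hodge_split j q dq 0 0 jn qH qdq (L2Lambda0 _ _).
  by move=> y dy yH _; rewrite ip0// normr0 mul0r.
exists p; split => //; split => // x [y yH yx].
by rewrite (porth _ _ yH yx) ip0.
Qed.

End hodge.

(** * Comparison of discrete and continuous forms *)

Section sobolev.
Context {R : realType} {n : nat} (Omega : set 'rV[R]_n).
Implicit Types (u v w z : dform R n) (s : R).
Local Notation nrm := (l2norm Omega).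
Local Notation ip := (inner Omega).
Local Notation leb := (@lebesgue_rV R n).
Let H := inner_semi Omega.

Lemma Hs_seminorm2_ge0 s z : (0 <= Hs_seminorm2 Omega s z)%E.
Proof.
rewrite /Hs_seminorm2; case: ifP => _.
  apply: le_ereal_inf_tmp => _ [g _ <-]; rewrite lee_fin; apply: sumr_ge0 => i _.
  exact: sqr_ge0.
apply: integral_ge0 => x _; apply: integral_ge0 => y _; rewrite lee_fin.
by rewrite divr_ge0 ?powR_ge0//; apply: sumr_ge0 => A _; exact: sqr_ge0.
Qed.

Lemma l2norm_le_Hs s z : nrm z <= Hs_norm Omega s z.
Proof.
have z0 : 0 <= nrm z by exact: sqrtr_ge0.
rewrite -[leLHS](ger0_norm z0) -sqrtr_sqr ler_sqrt.
  by rewrite lerDl fine_ge0// Hs_seminorm2_ge0.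
by rewrite addr_ge0 ?sqr_ge0// fine_ge0// Hs_seminorm2_ge0.
Qed.

Lemma s_regular_bound s k : s_regular Omega s -> (k <= n)%N ->
  exists2 c : R, 0 <= c & forall z dz deltaz, Zspace Omega k z ->
    is_d Omega k z dz -> is_delta Omega k z deltaz ->
    HsLambda Omega s k z /\ Hs_norm Omega s z <= c * (nrm dz + nrm deltaz).
Proof.
move=> /[apply] -[C zC]; exists (Num.sqrt `|C|) => [|z dz dlz zZ zdz zdlz].
  exact: sqrtr_ge0.
have [zs /(_ _ _ zdz zdlz) zle] := zC _ zZ; split => //.
have s0 w : 0 <= nrm w by exact: sqrtr_ge0.
rewrite -(@ler_pXn2r _ 2)// ?nnegrE ?mulr_ge0 ?addr_ge0 ?sqrtr_ge0//.
have pos : 0 <= nrm dz ^+ 2 + nrm dlz ^+ 2 by rewrite addr_ge0 ?sqr_ge0.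
apply: (le_trans zle); rewrite exprMn (sqr_sqrtr (normr_ge0 C)).
apply: (le_trans (ler_wpM2r pos (ler_norm C))).
rewrite ler_wpM2l// sqrrD addrAC lerDl.
by rewrite mulrn_wge0// mulr_ge0.
Qed.

(** Exactness and the projections are only given up to null sets; inner products do
    not see the difference. *)
Lemma inner_ae_eq w w' t : L2form Omega w -> L2form Omega w' -> L2form Omega t ->
  {ae leb, forall x, Omega x -> w x = w' x} -> ip w t = ip w' t.
Proof.
move=> wL wL' tL ww'; apply/eqP; rewrite -subr_eq0 -(ipBl H)//; apply/eqP.
apply: inner_ae0l => //; last exact: (si_memB H).
by apply: filterS ww' => x E Ox A; rewrite dform_subE E// subrr mul0r.
Qed.

Lemma nrm_ae_eq w w' : L2form Omega w -> L2form Omega w' ->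
  {ae leb, forall x, Omega x -> w x = w' x} -> nrm (w - w') = 0.
Proof.
move=> wL wL' ww'; have dL := si_memB H wL wL'.
rewrite /l2norm (ipBl H)// (inner_ae_eq wL wL' dL ww') subrr.
exact: sqrtr0.
Qed.

Lemma is_d_ae k u w w' : L2Lambda Omega k u -> is_d Omega k u w ->
  L2Lambda Omega k.+1 w' -> {ae leb, forall x, Omega x -> w x = w' x} ->
  is_d Omega k u w'.
Proof.
move=> uk [wk uw] wk' ww'; split => //; have uL := L2Lambda_L2form uk.
apply/(weak_extdP _ uL) => B f tf.
rewrite -(inner_ae_eq (L2Lambda_L2form wk) (L2Lambda_L2form wk') (monoform_L2form B tf) ww').
exact: (weak_extdP _ uL).1.
Qed.

End sobolev.

(** In both estimates [hs] stands for [h ^ s], while [G] and [D] stand for the norms of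
    the discrete codifferential and of the exterior derivative. *)
Lemma absorb_norm (R : realFieldType) (a1 a2 c1 c2 G D E x y r t hs : R) :
  - (G * x) <= r -> t <= y * E -> G * x <= G * (a1 * hs * (c2 * E)) ->
  y * E <= a2 * hs * (c1 * (D + G)) * E ->
  - r + t <= (a1 * c2 * G + a2 * c1 * (D + G)) * hs * E.
Proof. by move=> *; lra. Qed.

Lemma collect_rate (R : realFieldType) (a1 a2 c1 c2 G D hs : R) :
  0 <= c1 * hs * (D + G) -> 0 <= a1 * c2 * hs * D ->
  (a1 * c2 * G + a2 * c1 * (D + G)) * hs + a2 * hs * (c1 * (D + G)) <=
  (c1 + a1 * c2 + 2 * (a2 * c1)) * hs * (D + G).
Proof. by move=> *; lra. Qed.

Section discrete.
Context {R : realType} {n : nat} (Omega : set 'rV[R]_n) (s : R) (h : nat -> R).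
Context (V : nat -> nat -> set (dform R n)) (Pi : nat -> nat -> dform R n -> dform R n).
Implicit Types (u v w z q p b x g : dform R n) (j k m : nat).
Local Notation nrm := (l2norm Omega).
Local Notation ip := (inner Omega).
Local Notation leb := (@lebesgue_rV R n).
Hypothesis oO : open Omega.
Hypothesis bO : bounded_set Omega.
Hypothesis reg : s_regular Omega s.
Hypothesis fe : forall m, fe_complex Omega (V m).
Hypothesis bp : bounded_projections Omega s h V Pi.
Let mO : measurable Omega := open_rV_measurable oO.
Let H := inner_semi Omega.
Local Notation cl k := (sclosure (L2form Omega) ip (exact_form Omega k)).

Lemma V_Hring m k u : (k <= n)%N -> V m k u -> Hring Omega k u.
Proof. by move=> kn; have [/(_ k kn)[+ _ _ _ _] _] := fe m; apply. Qed.

Lemma V_L2Lambda m k u : (k <= n)%N -> V m k u -> L2Lambda Omega k u.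
Proof. by move=> kn /(V_Hring kn)/Hring_L2Lambda. Qed.

Lemma V_L2form m k u : (k <= n)%N -> V m k u -> L2form Omega u.
Proof. by move=> kn /(V_L2Lambda kn)/L2Lambda_L2form. Qed.

Lemma V_sub m k u v : (k <= n)%N -> V m k u -> V m k v -> V m k (u - v).
Proof.
move=> kn uV vV; have [/(_ k kn)[_ _ Vlin _ _] _] := fe m.
by rewrite addrC -scaleN1r; exact: Vlin.
Qed.

Lemma V_d m k u w : (k < n)%N -> V m k u -> is_d Omega k u w -> V m k.+1 w.
Proof. by move=> kn; have [_ [Vd _]] := fe m; exact: Vd. Qed.

Let H0 j : (j <= n)%N -> Hring Omega j 0.
Proof.
move=> jn; have [/(_ j jn)[_ V0 _ _ _] _] := fe 0%N.
exact: V_Hring V0.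
Qed.

Lemma is_d_sub k u v w z : L2Lambda Omega k u -> L2Lambda Omega k v ->
  is_d Omega k u w -> is_d Omega k v z -> is_d Omega k (u - v) (w - z).
Proof.
have E y y' : y - y' = (-1) *: y' + y :> dform R n by rewrite scaleN1r addrC.
move=> uk vk uw vz; rewrite (E u) (E w).
exact: is_d_lin.
Qed.

(** As [w] is discrete, the projection fixes it and commutes with [d]. *)
Lemma Pi_d m k u w : (k < n)%N -> Hring Omega k u -> is_d Omega k u w ->
  V m k.+1 w -> is_d Omega k (Pi m k u) w.
Proof.
move=> kn uH uw wV.
apply: (is_d_ae _ (Pi_commute bp m kn uH uw)).
- exact: (V_L2Lambda (ltnW kn) (Pi_range bp m (ltnW kn) uH)).
- exact: V_L2Lambda wV.
- exact: (Pi_id bp kn wV).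
Qed.

Lemma approx_bound k : (k <= n)%N -> exists2 c : R, 0 <= c & forall m z,
  HsLambda Omega s k z -> Hring Omega k z ->
  nrm (z - Pi m k z) <= c * h m `^ s * Hs_norm Omega s z.
Proof.
move=> kn; have [C zC] := Pi_approx bp kn; exists `|C| => // m z zs zH.
rewrite (le_trans (zC m z zs zH))// ler_wpM2r ?sqrtr_ge0// ler_wpM2r ?powR_ge0//.
exact: ler_norm.
Qed.

Lemma exact_projection j g : (j <= n)%N -> L2Lambda Omega j g ->
  exists p, [/\ L2Lambda Omega j p, cl j p &
    forall x, exact_form Omega j x -> ip p x = ip g x].
Proof.
move=> jn gj; apply: (projection H (@L2Lambda_L2form _ _ _ _)
  (@L2Lambda_complete _ _ _ mO j)).
- exact: exact0.
- by move=> a x y; exact: exact_lin.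
- by move=> x /exact_L2Lambda.
- exact: L2Lambda_L2form gj.
Qed.

(** Since [s]-regularity controls a full [H^s] norm, it contains a Poincare
    inequality for forms with zero codifferential. *)
Lemma coexact_norm j : (j <= n)%N -> exists2 c : R, 0 <= c & forall q dq p,
  Zspace Omega j (q - p) -> is_d Omega j (q - p) dq -> is_delta Omega j (q - p) 0 ->
  HsLambda Omega s j (q - p) /\ Hs_norm Omega s (q - p) <= c * nrm dq.
Proof.
move=> jn; have [c c0 cP] := s_regular_bound reg jn; exists c => // q dq p qZ qd qdel.
have [qs] := cP _ _ _ qZ qd qdel.
by rewrite /l2norm (ip0l H (si_mem0 H)) sqrtr0 addr0.
Qed.

(** The comparison described at the top.  In degree zero there are no exact forms, and
    [u] itself serves as [z]. *)
Lemma discrete_near_continuous k : (k <= n)%N -> exists2 c : R, 0 <= c &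
  forall m u du g, V m k u -> is_d Omega k u du -> is_dh_star Omega (V m) k u g ->
    exists z, [/\ HsLambda Omega s k z, Hring Omega k z,
      Hs_norm Omega s z <= c * (nrm du + nrm g) &
      nrm (u - z) <= c * h m `^ s * (nrm du + nrm g)].
Proof.
move=> kn; have [c1 c10 zbound] := s_regular_bound reg kn.
case: k kn zbound => [|j] kn zbound.
  exists c1 => // m u du g uV udu _; exists u.
  have uH := V_Hring kn uV; have u0 := Hring_L2Lambda uH.
  have [us ule] := zbound _ _ _ (Zspace0 uH) udu (is_delta0 u0).
  have g0 : 0 <= nrm g by exact: sqrtr_ge0.
  have du0 : 0 <= nrm du by exact: sqrtr_ge0.
  split => //.
    apply: (le_trans ule); rewrite ler_wpM2l// lerD2l /l2norm.
    by rewrite (ip0l H (si_mem0 H)) sqrtr0.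
  rewrite subrr /l2norm (ip0l H (si_mem0 H)) sqrtr0 mulr_ge0 ?addr_ge0//.
  by rewrite mulr_ge0// powR_ge0.
have jn : (j <= n)%N := ltnW kn.
have [c2 c20 qbound] := coexact_norm jn.
have [ak ak0 akP] := approx_bound kn; have [aj aj0 ajP] := approx_bound jn.
pose c := c1 + aj * c2 + 2 * (ak * c1).
exists c; first by rewrite !addr_ge0 ?mulr_ge0.
move=> m u du g uV udu [gV dh].
have uH := V_Hring kn uV; have uk := Hring_L2Lambda uH; have uL := L2Lambda_L2form uk.
have gj := V_L2Lambda jn gV; have gL := L2Lambda_L2form gj.
have [pg [pgj pgcl pgE]] := exact_projection jn gj.
have pgL := L2Lambda_L2form pgj.
have g'L := si_memB H gL pgL.
have g'j : L2Lambda Omega j (g - pg).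
  by rewrite addrC -scaleN1r; exact: L2Lambda_lin.
have exL x : exact_form Omega j x -> L2form Omega x.
  by move=> /exact_L2Lambda/L2Lambda_L2form.
have g'orth p : cl j p -> ip p (g - pg) = 0.
  move=> pcl; apply: (sclosure_exact_orth g'L pcl) => x xj.
  by rewrite (ipBr H gL pgL (exL _ xj)) -(si_sym H g) -(si_sym H pg) pgE// subrr.
have g'le : nrm (g - pg) <= nrm g.
  rewrite /l2norm ler_sqrt ?(si_ge0 H)// -[X in _ <= ip X X](subrK pg).
  have := ip_addscale H 1 g'L pgL; rewrite scale1r => ->.
  rewrite (si_sym H (g - pg) pg) (g'orth _ pgcl) mulr0 addr0 lerDl mulr_ge0 ?sqr_ge0//.
  exact: (si_ge0 H).
have g'bound q dq : Hring Omega j q -> is_d Omega j q dq ->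
    `|ip (g - pg) q| <= nrm (g - pg) * c2 * nrm dq.
  move=> qH qdq; have qL := L2Lambda_L2form (Hring_L2Lambda qH).
  have [p [pj pcl pZ [pd pdel _]]] := coexact_part oO bO H0 jn qH qdq.
  have [_ ple] := qbound _ _ _ pZ pd pdel.
  have pL := L2Lambda_L2form pj.
  have -> : ip (g - pg) q = ip (g - pg) (q - p).
    by rewrite (ipBr H qL pL g'L) (si_sym H _ p) g'orth// subr0.
  apply: (le_trans (cauchy_schwarz H g'L (si_memB H qL pL))).
  rewrite -mulrA ler_wpM2l ?sqrtr_ge0//.
  exact: (le_trans (l2norm_le_Hs Omega s (q - p)) ple).
have [b [bk bcl zZ [zd zdel zE]]] := hodge_split oO bO H0 kn uH udu g'j g'bound.
set z := u - b in zZ zd zdel zE.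
have [zs zle] := zbound _ _ _ zZ zd zdel.
have zH := zZ.1; have zL := L2Lambda_L2form (Hring_L2Lambda zH).
have PzV : V m j.+1 (Pi m j.+1 z) by exact: Pi_range bp _ _ _ kn zH.
have PzL := V_L2form kn PzV.
pose e := u - Pi m j.+1 z.
have eV : V m j.+1 e by exact: V_sub.
have eL := V_L2form kn eV.
have ed : is_d Omega j.+1 e 0.
  have [kn'|nk] := ltnP j.+1 n; last first.
    have kE : j.+1 = n by apply/eqP; rewrite eqn_leq kn nk.
    by apply: is_d_top => //; exact: V_L2Lambda eV.
  rewrite -(subrr du); apply: is_d_sub => //; first exact: V_L2Lambda PzV.
  by apply: Pi_d => //; exact: V_d udu.
have [p pV pe] : exists2 p, V m j p & is_d Omega j p e.
  by have [_ [_ /(_ _ _ kn eV ed)]] := fe m.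
have pH := V_Hring jn pV; have pL := V_L2form jn pV.
have [p2 [p2j p2cl qZ [qd qdel qorth]]] := coexact_part oO bO H0 jn pH pe.
have [qs qle] := qbound _ _ _ qZ qd qdel.
have p2L := L2Lambda_L2form p2j.
set q := p - p2 in qZ qd qdel qorth qs qle.
have qH := qZ.1; have qL := si_memB H pL p2L.
have PqV : V m j (Pi m j q) by exact: Pi_range bp _ _ _ jn qH.
have PqL := V_L2form jn PqV.
have Pqd : is_d Omega j (Pi m j q) e by exact: Pi_d.
(* discrete closed forms [t] are orthogonal to [g], since [(g, t) = (u, d t)] *)
have gpq : ip g p = ip g (Pi m j q).
  apply/eqP; rewrite -subr_eq0 -(ipBr H pL PqL gL).
  have td : is_d Omega j (p - Pi m j q) 0.
    by rewrite -(subrr e); apply: is_d_sub => //; [exact: V_L2Lambda jn pV|exact: V_L2Lambda jn PqV].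
  by rewrite (dh _ _ (V_sub jn pV PqV) td) (ip0r H uL).
(* only two projection errors are left *)
have key : ip e e = - ip g (q - Pi m j q) + ip (z - Pi m j.+1 z) e.
  have ue : ip u e = ip g p by rewrite (dh _ _ pV pe).
  have ze : ip z e = ip (g - pg) p by exact: zE.
  have pgp : ip pg p = ip g p - ip g q.
    have -> : ip pg p = ip pg q + ip pg p2.
      by rewrite -(ipDr H qL p2L pgL) subrK.
    rewrite (sclosure_exact_orth qL pgcl) ?add0r => [|x xj]; last first.
      by rewrite (si_sym H) qorth.
    rewrite (ipBr H pL p2L gL) opprB addrCA subrr addr0.
    rewrite (si_sym H pg) (si_sym H g).
    apply: (sclosure_ip H (@exact_L2form _ _ _ j) pgL gL p2cl) => x xj.
    by rewrite (si_sym H x) pgE// (si_sym H g).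
  rewrite (ipBl H zL PzL eL) (ipBr H qL PqL gL) -gpq ze (ipBl H gL pgL pL) pgp.
  by rewrite {1}/e (ipBl H uL PzL eL) ue; ring.
have e0 : 0 <= nrm e by exact: sqrtr_ge0.
have h0 : 0 <= h m `^ s by exact: powR_ge0.
have g0 : 0 <= nrm g by exact: sqrtr_ge0.
have du0 : 0 <= nrm du by exact: sqrtr_ge0.
have zle' : Hs_norm Omega s z <= c1 * (nrm du + nrm g).
  by apply: (le_trans zle); rewrite ler_wpM2l// lerD2l.
have zPz : nrm (z - Pi m j.+1 z) <= ak * h m `^ s * (c1 * (nrm du + nrm g)).
  by apply: (le_trans (akP m z zs zH)); rewrite ler_wpM2l// mulr_ge0.
have qPq : nrm (q - Pi m j q) <= aj * h m `^ s * (c2 * nrm e).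
  by apply: (le_trans (ajP m q qs qH)); rewrite ler_wpM2l// mulr_ge0.
have ele : nrm e <= (aj * c2 * nrm g + ak * c1 * (nrm du + nrm g)) * h m `^ s.
  have [->|en0] := eqVneq (nrm e) 0.
    by rewrite !(mulr_ge0, addr_ge0).
  have egt0 : 0 < nrm e by rewrite lt_def en0.
  rewrite -(ler_pM2r egt0) -expr2 (nrm_sqr H) key.
  have h1 : `|ip g (q - Pi m j q)| <= nrm g * nrm (q - Pi m j q).
    exact: (cauchy_schwarz H gL (si_memB H qL PqL)).
  have h2 : ip (z - Pi m j.+1 z) e <= nrm (z - Pi m j.+1 z) * nrm e.
    exact: (ip_le H (si_memB H zL PzL) eL).
  move: h1; rewrite ler_norml => /andP[h1 _].
  have h3 := ler_wpM2l g0 qPq; have h4 := ler_wpM2r e0 zPz.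
  exact: (absorb_norm h1 h2 h3 h4).
have [cz t1 t2] : [/\ c1 <= c, 0 <= c1 * h m `^ s * (nrm du + nrm g) &
    0 <= aj * c2 * h m `^ s * nrm du].
  by split; rewrite ?(mulr_ge0, addr_ge0)// /c -addrA lerDl addr_ge0 ?mulr_ge0.
exists z; split => //.
  by apply: (le_trans zle'); rewrite ler_wpM2r ?addr_ge0.
have -> : u - z = e - (z - Pi m j.+1 z).
  by rewrite /e [in RHS]opprB addrA subrK.
have := nrmB H eL (si_memB H zL PzL); rewrite -/(l2norm _ _) => /le_trans; apply.
apply: (le_trans (lerD ele zPz)).
exact: collect_rate.
Qed.

End discrete.

(** * Discrete compactness *)

Lemma powR_cvg0 (R : realType) (s : R) (h : nat -> R) : 0 < s ->
  (forall m, 0 < h m) -> h @ \oo --> (0 : R) ->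
  forall e, 0 < e -> exists N, forall m, (N <= m)%N -> h m `^ s <= e.
Proof.
move=> s0 h0 /cvgrPdist_lt hcvg e e0.
have [N _ NP] := hcvg _ (powR_gt0 s^-1 e0); exists N => m /NP /=.
rewrite sub0r normrN gtr0_norm// => hm.
have -> : e = (e `^ s^-1) `^ s by rewrite -powRrM mulVf ?gt_eqF// powRr1// ltW.
by apply: ge0_ler_powR; rewrite ?nnegrE ?powR_ge0 ?(ltW s0) ?(ltW (h0 m)) ?(ltW hm).
Qed.

Theorem theorem2 (R : realType) (n : nat) (Omega : set 'rV[R]_n) (s : R)
    (k : nat) (h : nat -> R) (T : nat -> set (set 'rV[R]_n))
    (V : nat -> nat -> set (dform R n))
    (Pi : nat -> nat -> dform R n -> dform R n)
    (u du dhu : nat -> dform R n) (C : R) :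
  bounded_domain Omega -> trivial_cohomology Omega ->
  2^-1 <= s <= 1 -> s_regular Omega s ->
  (k <= n)%N ->
  (forall m, 0 < h m) -> decreasing_seq h -> h @ \oo --> (0 : R) ->
  (forall m, mesh_of Omega (T m) /\ mesh_size (T m) = h m) ->
  shape_regular T ->
  (forall m, fe_complex Omega (V m)) ->
  bounded_projections Omega s h V Pi ->
  0 < C ->
  (forall m, V m k (u m)) ->
  (forall m, is_d Omega k (u m) (du m)) ->
  (forall m, is_dh_star Omega (V m) k (u m) (dhu m)) ->
  (forall m, l2norm Omega (du m) + l2norm Omega (dhu m) <= C) ->
  exists2 phi : nat -> nat, {homo phi : i j / (i < j)%N} &
    exists2 u0 : dform R n, L2Lambda Omega k u0 &
      l2norm Omega (u (phi m) - u0) @[m --> \oo] --> (0 : R).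
Proof.
move=> [oO _ _ bO] _ /andP[s12 _] reg kn h0 _ hcvg _ _ fe bp C0 uV udu udh uC.
have H := inner_semi Omega; have mO := open_rV_measurable oO.
have s0 : 0 < s by apply: lt_le_trans s12; rewrite invr_gt0.
have hs := powR_cvg0 s0 h0 hcvg.
have hs_le (c e : R) : 0 <= c -> 0 < e -> exists N, forall m, (N <= m)%N -> c * h m `^ s <= e.
  move=> c0 e0; have c1 : 0 < c + 1 by rewrite ltr_pwDr.
  have [N NP] := hs _ (divr_gt0 e0 c1); exists N => m /NP hm.
  apply: (le_trans (ler_wpM2l c0 hm)).
  by rewrite mulrCA ger_pMr// ler_pdivrMr// mul1r lerDl.
have [c c0 near_z] := discrete_near_continuous oO bO reg fe bp kn.
have /choice[z zP] m : exists z, [/\ HsLambda Omega s k z, Hring Omega k z,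
    Hs_norm Omega s z <= c * C & l2norm Omega (u m - z) <= c * C * h m `^ s].
  have [z [zs zH zle uz]] := near_z _ _ _ _ (uV m) (udu m) (udh m).
  exists z; split => //; first by apply: (le_trans zle); rewrite ler_wpM2l.
  by apply: (le_trans uz); rewrite mulrAC ler_wpM2r ?powR_ge0// ler_wpM2l.
have zk m : L2Lambda Omega k (z m) by have [_ /Hring_L2Lambda] := zP m.
have zL m := L2Lambda_L2form (zk m).
have uL m : L2form Omega (u m) := V_L2form fe kn (uV m).
have cC0 : 0 <= c * C by rewrite mulr_ge0// ltW.
have [|phi phi_incr phi_cauchy] := cauchy_subsequence H zL.
  move=> e e0; have [a a0 aP] := approx_bound bp kn.
  have [m0 /(_ _ (leqnn _)) m0P] := hs_le (a * (c * C)) e (mulr_ge0 a0 cC0) e0.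
  have [/(_ k kn)[_ _ _ _ [N [b [bV bspan]]]] _] := fe m0.
  have PzV i : V m0 k (Pi m0 k (z i)) by apply: (Pi_range bp) => //; have [] := zP i.
  have /choice[d dP] i := bspan _ (PzV i).
  (* basis and coordinates, extended by zero from ['I_N] to [nat] *)
  pose b' l := oapp b 0 (insub l).
  pose d' i l := oapp (d i) 0 (insub l).
  have b'L l : L2form Omega (b' l).
    rewrite /b'; case: insubP => [l' _ _|_] /=; last exact: (si_mem0 H).
    exact: (V_L2form fe kn (bV l')).
  have PzE i : {ae @lebesgue_rV R n, forall x, Omega x ->
      Pi m0 k (z i) x = (\sum_(l < N) d' i l *: b' l) x}.
    apply: filterS (dP i) => x /[apply] ->.
    rewrite (big_morph (fun f : dform R n => f x) (id1 := 0) (op1 := +%R))//.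
    by apply: eq_bigr => l _; rewrite /d' /b' valK.
  have near i : l2norm Omega (z i - \sum_(l < N) d' i l *: b' l) <= e.
    have SL := si_mem_sum H N (d' i) b'L; have PL := V_L2form fe kn (PzV i).
    apply: (le_trans (nrm_tri H (zL i) SL PL)).
    rewrite -!/(l2norm _ _) (nrm_ae_eq PL SL (PzE i)) addr0.
    have [zs zH zle _] := zP i; apply: (le_trans (aP m0 _ zs zH)).
    apply: (le_trans _ m0P); rewrite [leRHS]mulrAC ler_wpM2l// mulr_ge0//.
    exact: powR_ge0.
  exists N, b', d', (c * C + e); split=> // i.
  have SL := si_mem_sum H N (d' i) b'L.
  rewrite -[X in inner _ X X](subKr (z i)).
  apply: (le_trans (nrmB H (zL i) (si_memB H (zL i) SL))).
  apply: lerD; last exact: near.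
  by have [_ _ zle _] := zP i; exact: le_trans (l2norm_le_Hs Omega s _) zle.
have [u0 u0k zu0] := L2Lambda_complete mO (fun m => zk (phi m)) phi_cauchy.
exists phi => //; exists u0 => //; apply/cvgrPdist_le => e e0.
have phi_ge m : (m <= phi m)%N.
  by elim: m => // m IH; apply: (leq_ltn_trans IH); exact: phi_incr.
have e20 : 0 < e / 2 by rewrite divr_gt0.
have [N1 N1P] := zu0 _ e20; have [N2 N2P] := hs_le _ _ cC0 e20.
exists (maxn N1 N2) => // m /=; rewrite geq_max => /andP[m1 m2].
rewrite sub0r normrN ger0_norm ?sqrtr_ge0// [e]splitr.
apply: (le_trans (nrm_tri H (uL _) (L2Lambda_L2form u0k) (zL (phi m)))).
apply: lerD; last exact: N1P.
have [_ _ _ uz] := zP (phi m); apply: (le_trans uz); apply: N2P.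
exact: leq_trans m2 (phi_ge m).
Qed.
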